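(* Let $\gamma$ be a fixed irrational number of finite type $\tau<\infty$. Then for every real number $\varepsilon$ with $0<\varepsilon<1/(8\tau)$ there is a number $\eta>0$ such that the bound $$\left|\sum_{m\leqslant M}\Lambda(qm+a)\,\mathbf{e}(\gamma k m)\right|\leqslant M^{1-\eta}$$ holds for all integers $k,a,q$ with $1\leqslant k\leqslant M^{\varepsilon}$, $0\leqslant a<q\leqslant M^{\varepsilon/4}$ and $\gcd(a,q)=1$, provided that $M$ is sufficiently large (in terms of $\gamma$ and $\varepsilon$ only, uniformly in $k,a,q$).
   Context: For a real $x$, $\|x\|$ denotes the distance from $x$ to the nearest integer. The type of an irrational number $\gamma$ is $\tau=\sup\{\varrho\in\mathbb{R} : \liminf_{n\to\infty,\,n\in\mathbb{N}} n^{\varrho}\|\gamma n\|=0\}$; $\gamma$ is of finite type if $\tau<\infty$. $\mathbf{e}(x)=e^{2\pi i x}$, and $\Lambda$ is the von Mangoldt function: $\Lambda(n)=\log p$ if $n$ is a power of a prime $p$, and $\Lambda(n)=0$ otherwise. Sums over $m\leqslant M$ range over positive integers $m$. *)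

(* Defs.v *)
From HB Require Import structures.
From mathcomp Require Import all_boot all_order all_algebra.
From mathcomp Require Import all_classical all_reals all_analysis.
From mathcomp Require Export complex.

Set Implicit Arguments.
Unset Strict Implicit.
Unset Printing Implicit Defensive.

Import Order.TTheory GRing.Theory Num.Theory.
Import numFieldNormedType.Exports.

Local Open Scope classical_set_scope.
Local Open Scope ring_scope.

Definition dist_int {R : realType} (x : R) : R :=
  inf [set `|x - z%:~R| | z in [set: int]].

(* The supremum is taken in the extended reals, so that numbers of infinite
   type get the value +oo.  The term n = 0 does not affect the limit inferior. *)
Definition irr_type {R : realType} (gamma : R) : \bar R :=
  ereal_sup [set rho%:E | rho in [set rho : R |
    limn_einf (fun n : nat => (n%:R `^ rho * dist_int (gamma * n%:R))%:E)
      = 0%E]].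

Definition expi {R : realType} (x : R) : R[i] :=
  (cos (2 * pi * x) +i* sin (2 * pi * x))%C.

(* [primes n] lists the distinct prime divisors of n (and is empty for n = 0),
   hence it is a singleton [:: p] exactly when n = p ^ j with j >= 1; see the
   two lemmas below. *)
Definition von_mangoldt {R : realType} (n : nat) : R :=
  if primes n is [:: p] then ln p%:R else 0.

Lemma von_mangoldt_pfactor (R : realType) (p j : nat) :
  prime p -> von_mangoldt (p ^ j.+1) = ln p%:R :> R.
Proof. by move=> pp; rewrite /von_mangoldt primesX// primes_prime. Qed.

Lemma von_mangoldt_eq0 (R : realType) (n : nat) :
  (forall p j : nat, prime p -> n <> (p ^ j.+1)%N) -> von_mangoldt n = 0 :> R.
Proof.
move=> np; rewrite /von_mangoldt.
case: (posnP n) => [->//|n0].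
case E: (primes n) => [|p [|? ?]]//.
have pn : p \in primes n by rewrite E mem_head.
have pp : prime p by move: pn; rewrite mem_primes => /andP[].
exfalso; apply: (np p (logn p n).-1 pp).
rewrite prednK ?logn_gt0//.
by rewrite {1}(prod_prime_decomp n0) prime_decompE E/= big_seq1.
Qed.

(* Main.v *)
(* With N about qM, additive characters modulo q detect the progression, so it suffices to bound
   sum_(n <= N) Lambda(n) e(n theta) for theta = (gamma k + h) / q.  Since gamma has type tau,
   ||gamma n|| >= c n^(-rho) for every rho > tau; Dirichlet's theorem forces rho >= 1, hence
   eps < 1/8, and ||j theta|| >= delta := c M^(-eps/4 - 13 eps rho/8) for 1 <= j <= r := s^2,
   where s = M^(5 eps/16).  This lower bound replaces a rational approximation of theta: among
   any r consecutive j at most one has ||j theta|| < delta/2, which controls the sums of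
   min(N/j, 1/||j theta||) produced by Vaughan's identity.  In the bilinear part, the
   Cauchy-Schwarz inequality with weight n (in the form of AM-GM with a fixed parameter) avoids
   dyadic decomposition, and the mean square of the divisor function bounds the coefficients.
   With U = M^(21/64) <= N^(1/3) and r <= delta U the sum is O(N log^4 N / s), a saving of
   M^(eps/16) over M because N <= 2 M^(1 + eps/4). *)
Require Import Defs.
From mathcomp Require Import all_boot all_order all_algebra.
From mathcomp Require Import all_classical all_reals all_analysis.
From mathcomp Require Import zify ring lra.

Import Order.TTheory GRing.Theory Num.Theory.
Import numFieldNormedType.Exports.
Local Open Scope ring_scope.

Local Notation normc := Normc.normc.

(** * Distance to the nearest integer and exponential sums *)

Lemma dist_int_le {R : realType} (x : R) (z : int) : dist_int x <= `|x - z%:~R|.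
Proof.
apply: ge_inf; last by exists z.
by exists 0 => _ /= [w _ <-].
Qed.

Lemma dist_int_min {R : realType} (x : R) :
  exists2 z : int, dist_int x = `|x - z%:~R| & `|x - z%:~R| <= 1 / 2.
Proof.
pose z := Num.floor (x + 1 / 2).
have zx : `|x - z%:~R| <= 1 / 2.
  have /andP[] := floor_itv (x + 1 / 2).
  rewrite -/z intrD => h1 h2; rewrite ler_norml; apply/andP; split; lra.
exists z => //; apply/eqP; rewrite eq_le dist_int_le/=.
apply: lb_le_inf; first by exists `|x - z%:~R|, z.
move=> _ /= [w _ <-].
have [->//|wz] := eqVneq w z.
have : 1 <= `|(z - w)%:~R : R|.
  by rewrite -intr_norm ler1z -gtz0_ge1 normr_gt0 subr_eq0 eq_sym.
rewrite intrB => h.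
have := ler_distD x (z%:~R) (w%:~R : R).
rewrite [`|z%:~R - x|]distrC; lra.
Qed.

Lemma dist_int_ge0 {R : realType} (x : R) : 0 <= dist_int x.
Proof. by have [z ->] := dist_int_min x. Qed.

Lemma dist_intB {R : realType} (x y : R) :
  dist_int (x - y) <= dist_int x + dist_int y.
Proof.
have [z -> _] := dist_int_min x; have [w -> _] := dist_int_min y.
apply: le_trans (dist_int_le _ (z - w)) _; rewrite intrB.
rewrite (_ : x - y - _ = (x - z%:~R) - (y - w%:~R)); last by ring.
exact: ler_normB.
Qed.

Lemma dist_intMn {R : realType} (x : R) (n : nat) :
  dist_int (n%:R * x) <= n%:R * dist_int x.
Proof.
have [z -> _] := dist_int_min x.
apply: le_trans (dist_int_le _ (n%:Z * z)) _.
by rewrite intrM -mulrBr normrM ger0_norm ?ler0n.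
Qed.

Lemma dist_intDz {R : realType} (x : R) (z : int) :
  dist_int (x + z%:~R) = dist_int x.
Proof.
have le (y : R) (w : int) : dist_int (y + w%:~R) <= dist_int y.
  have [v -> _] := dist_int_min y.
  apply: le_trans (dist_int_le _ (v + w)) _; rewrite intrD.
  by rewrite opprD addrACA subrr addr0.
apply/eqP; rewrite eq_le le /=.
by have := le (x + z%:~R) (- z); rewrite mulrNz addrK.
Qed.

(** By duplication and the mean value theorem on [0, x/2], sin x = x cos(x/2) cos c with 0 <= c <=
    x/2. Both cosines are at least cos(pi/4), whose square is 1/2. *)
Lemma sin_ge_half {R : realType} (x : R) : 0 <= x <= pi / 2 -> x / 2 <= sin x.
Proof.
have pi0 := pi_gt0 R.
move=> /andP[x0 xpi].
have cos4 : 1 / 2 <= cos (pi / 4 : R) ^+ 2.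
  have := cos_mulr2n (pi / 4 : R).
  rewrite (_ : pi / 4 *+ 2 = pi / 2 :> R); last by rewrite mulr2n; field.
  rewrite cos_pihalf mulr2n; lra.
have cospos (y : R) : 0 <= y <= pi / 4 -> 0 <= cos y.
  by move=> /andP[h1 h2]; apply: cos_ge0_pihalf; apply/andP; split; lra.
have cosdec (y : R) : 0 <= y <= pi / 4 -> cos (pi / 4) <= cos y.
  move=> /andP[h1 h2]; case: (eqVneq y (pi / 4)) => [->//|ne].
  rewrite ltW// ltr_cos ?in_itv/=; first by rewrite lt_neqAle ne.
    by apply/andP; split; lra.
  by apply/andP; split; lra.
have c40 : 0 <= cos (pi / 4 : R) by apply: cospos; apply/andP; split; lra.
have [c cx sE] : exists2 c : R, c \in `[0, x / 2] & sin (x / 2) - sin 0 = cos c * (x / 2 - 0).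
  apply: (@MVT_segment R sin cos); first by rewrite divr_ge0.
  by apply: continuous_subspaceT => y; exact: continuous_sin.
move: cx; rewrite in_itv/= => /andP[c0 cx].
move: sE; rewrite sin0 !subr0 => sE.
have cc : cos (pi / 4) <= cos c by apply: cosdec; apply/andP; split; lra.
have cx2 : cos (pi / 4) <= cos (x / 2) by apply: cosdec; apply/andP; split; lra.
have -> : sin x = (cos (x / 2) * cos c) * x.
  rewrite -[in LHS](_ : (x / 2) *+ 2 = x); last by rewrite mulr2n; field.
  by rewrite sin_mulr2n sE -mulr_natr; field.
have : cos (pi / 4) ^+ 2 <= cos (x / 2) * cos c.
  by rewrite expr2; apply: ler_pM.
nra.
Qed.

(** Since |sin(pi x)| is 1-periodic and even, x may be replaced by its distance t <= 1/2 to the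
    nearest integer; then [sin_ge_half] and pi >= 2 suffice. *)
Lemma norm_sin_pi {R : realType} (x : R) : dist_int x <= `|sin (pi * x)|.
Proof.
have [z -> zx] := dist_int_min x.
have pi2 := pi_ge2 R.
have sinDpin (y : R) (n : nat) : `|sin (y + n%:R * pi)| = `|sin y|.
  by rewrite mulr_natl (alternatingn (@sinDpi R)) normrM normrX normrN1 expr1n mul1r.
have -> : `|sin (pi * x)| = `|sin (pi * (x - z%:~R))|.
  case: z {zx} => n.
    rewrite -(sinDpin (pi * (x - n%:R)) n).
    by have -> : pi * (x - n%:R) + n%:R * pi = pi * x by ring.
  rewrite -(sinDpin (pi * x) n.+1) NegzE mulrNz opprK.
  by have -> : pi * x + n.+1%:R * pi = pi * (x + n.+1%:R) by ring.
set y := x - _ in zx *.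
have -> : `|sin (pi * y)| = `|sin (pi * `|y|)|.
  by case: (ger0P y) => // _; rewrite mulrN sinN normrN.
have y0 := normr_ge0 y; move: (`|y|) y0 zx => t t0 t2.
have := @sin_ge_half R (pi * t).
have -> : 0 <= pi * t <= pi / 2 by apply/andP; split; nra.
move=> /(_ isT) h; apply: le_trans (ler_norm _); nra.
Qed.

(** * The additive character [expi] and its geometric sums *)

Lemma expi0 {R : realType} : expi (0 : R) = 1.
Proof. by rewrite /expi mulr0 cos0 sin0. Qed.

Lemma expiD {R : realType} (x y : R) : expi (x + y) = expi x * expi y.
Proof.
rewrite /expi mulrDr cosD sinD; apply/eqP; rewrite eq_complex/=.
by rewrite eqxx /= addrC [sin _ * cos _]mulrC mulrC [sin _ * cos _]mulrC addrC mulrC eqxx.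
Qed.

Lemma expiMn {R : realType} (x : R) (n : nat) : expi (n%:R * x) = expi x ^+ n.
Proof.
elim: n => [|n IH]; first by rewrite mul0r expi0.
by rewrite -natr1 mulrDl mul1r expiD IH exprSr.
Qed.

Lemma expi_nat {R : realType} (n : nat) : expi (n%:R : R) = 1.
Proof.
rewrite -[n%:R]mulr1 expiMn /expi mulr1 mulr_natl cos2pi sin2pi.
by rewrite (_ : (1 +i* 0)%C = 1) ?expr1n.
Qed.

Lemma normc_expi {R : realType} (x : R) : normc (expi x) = 1.
Proof. by rewrite /= cos2Dsin2 sqrtr1. Qed.

Lemma normc_ge0 {R : realType} (z : R[i]) : 0 <= normc z.
Proof. by case: z => a b; exact: sqrtr_ge0. Qed.

(** The modulus equals 2 |sin(pi x)|, by the duplication formulas. *)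
Lemma normcB1_expi {R : realType} (x : R) : 2 * dist_int x <= normc (expi x - 1).
Proof.
rewrite /= /expi; have := norm_sin_pi x; set s := `|_| => h.
rewrite (_ : _ + _ = (2 * s) ^+ 2); last first.
  have -> : 2 * pi * x = (pi * x) *+ 2 by rewrite mulr2n; ring.
  rewrite cos_mulr2n sin_mulr2n exprMn /s real_normK ?num_real// subr0.
  have := cos2Dsin2 (pi * x); set a := cos _; set b := sin _ => ab.
  have -> : a ^+ 2 = 1 - b ^+ 2 by rewrite -ab addrK.
  rewrite -[(a * b) *+ 2]mulr_natr !exprMn.
  have -> : a ^+ 2 = 1 - b ^+ 2 by rewrite -ab addrK.
  by rewrite !mulr2n; ring.
by rewrite sqrtr_sqr ger0_norm ?mulr_ge0// ?ler_pM2l// /s.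
Qed.

Lemma normc_sum {R : realType} (I : Type) (r : seq I) (P : pred I) (F : I -> R[i]) :
  normc (\sum_(i <- r | P i) F i) <= \sum_(i <- r | P i) normc (F i).
Proof.
elim/big_rec2: _ => [|i x y _ h]; first by rewrite Normc.normc0.
by apply: le_trans (le_normcD _ _) _; rewrite lerD2l.
Qed.

Lemma normc_real {R : realType} (x : R) : normc (x%:C)%C = `|x|.
Proof. by rewrite /= expr0n addr0 sqrtr_sqr. Qed.

Lemma normc_expi_sum {R : realType} (x : R) (a b : nat) :
  normc (\sum_(a <= m < b) expi (m%:R * x)) <= (b - a)%:R.
Proof.
apply: le_trans (normc_sum _ _ _ _) _.
under eq_bigr do rewrite normc_expi.
by rewrite sumr_const_nat.
Qed.

(** Multiplication by e(x) - 1 telescopes the geometric sum. A product instead of a quotient also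
    covers integral x, where the distance is 0. *)
Lemma normc_expi_geom {R : realType} (x : R) (a b : nat) :
  normc (\sum_(a <= m < b) expi (m%:R * x)) * dist_int x <= 1.
Proof.
have [ba|ab] := leqP b a.
  by rewrite big_geq// Normc.normc0 mul0r.
set S := \sum_(_ <= _ < _) _.
have -> : S = \sum_(a <= m < b) expi x ^+ m by apply: eq_bigr => m _; rewrite expiMn.
have h : normc ((\sum_(a <= m < b) expi x ^+ m) * (expi x - 1)) <= 2.
  have -> : (\sum_(a <= m < b) expi x ^+ m) * (expi x - 1) = expi x ^+ b - expi x ^+ a.
    rewrite big_distrl/= -(telescope_sumr _ (ltnW ab)).
    by apply: eq_bigr => m _; rewrite mulrBr mulr1 exprSr.
  apply: le_trans (le_normcD _ _) _.
  by rewrite normcN -!expiMn !normc_expi.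
rewrite Normc.normcM in h.
have := normcB1_expi x; have := normc_ge0 (\sum_(a <= m < b) expi x ^+ m).
have := dist_int_ge0 x.
nra.
Qed.

(** * Sums over well-spaced frequencies *)

Lemma ler_sum_at_most_one {R : realType} (c : R) (P : pred nat) (a b : nat) :
  0 <= c -> (forall i j, P i -> P j -> (i <= j)%N) ->
  \sum_(a <= j < b | P j) c <= c.
Proof.
move=> c0 uP.
have [[i /andP[Pi iab]]|nP] := pselect (exists i, P i && (a <= i < b)%N).
  rewrite big_mkcond (bigD1_seq i) ?iota_uniq ?mem_index_iota//= Pi.
  rewrite big1 ?addr0// => j ji; case: ifP => // Pj.
  by move: ji; rewrite eqn_leq !uP.
rewrite big_nat_cond big_pred0// => j; apply/negP => /andP[h1 h2].
by apply: nP; exists j; rewrite h1 h2.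
Qed.

(* The indices j with ||jx|| < delta/2 are more than r apart (also from 0), so the windows
   ]j - r, j] are disjoint, and w j is at most the mean of w over its window. *)
Lemma spaced_sum_le {R : realType} (x delta B : R) (r J : nat) (w E : nat -> R) :
  (0 < r)%N -> 0 < delta ->
  (forall j, (0 < j <= r)%N -> delta <= dist_int (j%:R * x)) ->
  (forall i j, (0 < i <= j)%N -> w j <= w i) ->
  (forall j, (0 < j)%N -> 0 <= w j) ->
  (forall j, (0 < j <= J)%N -> 0 <= E j <= w j) ->
  (forall j, (0 < j <= J)%N -> E j * dist_int (j%:R * x) <= B) ->
  \sum_(1 <= j < J.+1) E j <=
    r%:R^-1 * \sum_(1 <= i < J.+1) w i + 2 * J%:R * B / delta.
Proof.
move=> r0 d0 sep wdec w0 Ew EB.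
pose bad j := dist_int (j%:R * x) < delta / 2.
have badsep i j : bad i -> bad j -> (i < j)%N -> (i + r < j)%N.
  move=> bi bj ij; rewrite ltnNge; apply/negP => jir.
  have /sep : (0 < j - i <= r)%N by lia.
  rewrite natrB ?(ltnW ij)// mulrBl.
  have := dist_intB (j%:R * x) (i%:R * x); rewrite /bad in bi bj; lra.
(* Counting 0 as a bad index forces every positive bad j above r, so that its window consists of
   positive integers. *)
have bad0 : bad 0%N.
  rewrite /bad mul0r; apply: le_lt_trans (dist_int_le 0 0) _.
  by rewrite subrr normr0 divr_gt0.
(* An index that is not bad has distance at least delta/2, hence contributes at most 2B/delta. *)
have step1 : \sum_(1 <= j < J.+1) E j <=
    \sum_(1 <= j < J.+1) ((if bad j then w j else 0) + 2 * B / delta).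
  apply: ler_sum_nat => j j1; have := EB j; have /andP[] := Ew j ltac:(lia).
  move=> E0 Ewj /(_ ltac:(lia)) EBj.
  have B0 : 0 <= B by apply: le_trans EBj; rewrite mulr_ge0// dist_int_ge0.
  have Bd : 0 <= 2 * B / delta by rewrite divr_ge0 ?mulr_ge0// ltW.
  rewrite /bad; case: ltP => h; first by lra.
  rewrite add0r ler_pdivlMr//.
  have : E j * (delta / 2) <= E j * dist_int (j%:R * x) by rewrite ler_wpM2l.
  lra.
apply: le_trans step1 _; rewrite big_split/= lerD//; last first.
  by rewrite sumr_const_nat subn1/= -mulr_natr; lra.
rewrite -big_mkcond/= mulrC ler_pdivlMr ?ltr0n// mulr_suml.
pose Q i j := (i <= j < i + r)%N.
apply: (@le_trans _ _ (\sum_(1 <= j < J.+1 | bad j) \sum_(1 <= i < J.+1 | Q i j) w i)).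
  rewrite big_nat_cond [leRHS]big_nat_cond.
  apply: ler_sum => j /andP[/andP[j1 jJ] bj].
  have rj : (r < j)%N by have := badsep _ _ bad0 bj j1.
  have -> : \sum_(1 <= i < J.+1 | Q i j) w i = \sum_(j.+1 - r <= i < j.+1) w i.
    rewrite (@big_nat_widen _ _ _ _ j.+1 J.+1)//.
    rewrite (@big_nat_widenl _ _ _ (j.+1 - r) 1); last by rewrite subn_gt0 leqW.
    by apply: eq_bigl => i; rewrite /Q /= ltnS leq_subLR addnC.
  rewrite mulr_natr -[leLHS](_ : \sum_(j.+1 - r <= i < j.+1) w j = _); last first.
    by rewrite sumr_const_nat subKn//; lia.
  by apply: ler_sum_nat => i hi; apply: wdec; lia.
(* By disjointness, each i lies in the window of at most one bad j. *)
rewrite (exchange_big_dep_nat xpredT)//=.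
apply: ler_sum_nat => i i1; apply: ler_sum_at_most_one; first by apply: w0; lia.
move=> j k /andP[bj Qj] /andP[bk Qk]; rewrite leqNgt; apply/negP => kj.
have := badsep _ _ bk bj kj; rewrite /Q in Qj Qk; lia.
Qed.

(** Partial summation as an induction on the length: the base level u is raised to v a, which costs
    (v a - u) times a bound for a tail sum, and these costs telescope to W - u. The factor D allows
    both the trivial bound (D = 1) and the geometric one (D the distance to the nearest integer)
    without a division. *)
Lemma normc_abel_sum {R : realType} (z : nat -> R[i]) (v : nat -> R) (a b : nat) (u W D B : R) :
  0 <= D -> (forall c, (a <= c)%N -> normc (\sum_(c <= k < b) z k) * D <= B) ->
  (forall i j, (a <= i <= j)%N -> (j < b)%N -> v i <= v j) ->
  (forall i, (a <= i < b)%N -> u <= v i <= W) -> u <= W ->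
  normc (\sum_(a <= k < b) (v k - u)%:C%C * z k) * D <= (W - u) * B.
Proof.
move=> D0; elim: {a}(b - a)%N {-2}a (erefl (b - a)%N) u => [|n IH] a ban u zB vmon vb uW.
  rewrite big_geq; last by lia.
  rewrite Normc.normc0 mul0r mulr_ge0 ?subr_ge0//.
  by apply: le_trans (zB a _); [rewrite mulr_ge0// normc_ge0|lia].
have ab : (a < b)%N by lia.
have /andP[uva vaW] := vb a ltac:(lia).
have -> : \sum_(a <= k < b) (v k - u)%:C%C * z k =
    (v a - u)%:C%C * (\sum_(a <= k < b) z k) +
    \sum_(a.+1 <= k < b) (v k - v a)%:C%C * z k.
  rewrite [X in _ * X]big_ltn// mulrDr [LHS]big_ltn// -addrA; congr (_ + _).
  rewrite mulr_sumr -big_split/=; apply: eq_bigr => k _.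
  by rewrite -mulrDl -rmorphD/=; congr (_%:C%C * _); ring.
have h1 := zB a (leqnn a).
have h2 : normc (\sum_(a.+1 <= k < b) (v k - v a)%:C%C * z k) * D <= (W - v a) * B.
  apply: IH => //; first by lia.
  - by move=> c ac; apply: zB; lia.
  - by move=> i j ij jb; apply: vmon; lia.
  - by move=> i ib; rewrite vmon ?(andP (vb i _)).2//; lia.
apply: (@le_trans _ _ ((normc ((v a - u)%:C%C * (\sum_(a <= k < b) z k)) +
    normc (\sum_(a.+1 <= k < b) (v k - v a)%:C%C * z k)) * D)).
  by rewrite ler_wpM2r// le_normcD.
rewrite mulrDl Normc.normcM normc_real ger0_norm ?subr_ge0// -mulrA.
have : (v a - u) * (normc (\sum_(a <= k < b) z k) * D) <= (v a - u) * B.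
  by rewrite ler_wpM2l// subr_ge0.
nra.
Qed.

Lemma normc_weighted_expi_sum {R : realType} (x : R) (v : nat -> R) (a b : nat) (W : R) :
  (forall i j, (a <= i <= j)%N -> (j < b)%N -> v i <= v j) ->
  (forall i, (a <= i < b)%N -> 0 <= v i <= W) -> 0 <= W ->
  normc (\sum_(a <= k < b) (v k)%:C%C * expi (k%:R * x)) <= W * (b - a)%:R /\
  normc (\sum_(a <= k < b) (v k)%:C%C * expi (k%:R * x)) * dist_int x <= W.
Proof.
move=> vmon vb W0.
have E : \sum_(a <= k < b) (v k)%:C%C * expi (k%:R * x) =
         \sum_(a <= k < b) (v k - 0)%:C%C * expi (k%:R * x).
  by apply: eq_bigr => k _; rewrite subr0.
rewrite E; split.
  have := @normc_abel_sum R (fun k => expi (k%:R * x)) v a b 0 W 1 (b - a)%:R.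
  rewrite mulr1 subr0; apply => // c ac; rewrite mulr1.
  by apply: le_trans (normc_expi_sum _ _ _) _; rewrite ler_nat; lia.
have := @normc_abel_sum R (fun k => expi (k%:R * x)) v a b 0 W (dist_int x) 1.
rewrite mulr1 subr0; apply => //; first exact: dist_int_ge0.
by move=> c _; exact: normc_expi_geom.
Qed.

(** * Arithmetic functions *)

Lemma sum_multiples {V : nmodType} (d N : nat) (F : nat -> V) : (0 < d)%N ->
  \sum_(1 <= k < N.+1 | (d %| k)%N) F k = \sum_(1 <= e < (N %/ d).+1) F (d * e)%N.
Proof.
move=> d0; elim: N => [|N IH]; first by rewrite div0n !big_geq.
rewrite big_mkcond big_nat_recr//= -big_mkcond/= IH divnS//.
case: ifP => dN; last by rewrite addr0.
rewrite add1n [RHS]big_nat_recr//=; congr (_ + F _).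
by have := divnS N d0; rewrite dN add1n => <-; rewrite mulnC divnK.
Qed.

(** Makes the range of the divisor independent of n, so that sums over n and over its divisors can
    be exchanged. *)
Lemma sum_divisors_widen {V : nmodType} (n N : nat) (F : nat -> V) :
  (0 < n <= N)%N ->
  \sum_(1 <= d < N.+1 | (d %| n)%N) F d = \sum_(1 <= d < n.+1 | (d %| n)%N) F d.
Proof.
move=> /andP[n0 nN]; rewrite [RHS](@big_nat_widen _ _ _ _ _ N.+1)//.
apply: eq_bigl => d /=; case: (boolP (d %| n)%N) => //= dn.
by rewrite ltnS dvdn_leq.
Qed.

Lemma sum_divisors_exchange {V : nmodType} (N : nat) (F : nat -> nat -> V) :
  \sum_(1 <= k < N.+1) \sum_(1 <= d < N.+1 | (d %| k)%N) F d k =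
  \sum_(1 <= d < N.+1) \sum_(1 <= e < (N %/ d).+1) F d (d * e)%N.
Proof.
rewrite (exchange_big_dep_nat xpredT)//=.
by apply: eq_big_nat => d /andP[d0 _]; exact: sum_multiples.
Qed.

(** * The Moebius function *)

Definition moebius {R : realType} (n : nat) : R :=
  if all (fun p => logn p n == 1%N) (primes n) then (-1) ^+ size (primes n) else 0.

Lemma moebius1 {R : realType} : moebius 1 = 1 :> R.
Proof. by rewrite /moebius. Qed.

Lemma normr_moebius_le1 {R : realType} (n : nat) : `|moebius n : R| <= 1.
Proof.
rewrite /moebius; case: ifP => _; last by rewrite normr0.
by rewrite normrX normrN1 expr1n.
Qed.

Lemma moebius_primeM {R : realType} (p m : nat) : prime p -> (0 < m)%N ->
  moebius (p * m) = (if (p %| m)%N then 0 else - moebius m) :> R.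
Proof.
move=> pp m0; have p0 := prime_gt0 pp.
have pin : p \in primes (p * m) by rewrite mem_primes pp muln_gt0 p0 m0 dvdn_mulr.
have lpm q : logn q (p * m) = ((p == q) + logn q m)%N by rewrite lognM// logn_prime// eq_sym.
case: ifPn => pm.
  rewrite /moebius; case: allP => // /(_ p pin) /eqP.
  rewrite lpm eqxx; have : (0 < logn p m)%N by rewrite logn_gt0 mem_primes pp m0 pm.
  by case: logn.
have perm : perm_eq (primes (p * m)) (p :: primes m).
  apply: uniq_perm; first exact: primes_uniq.
    by rewrite /= primes_uniq mem_primes (negPf pm) !andbF.
  by move=> q; rewrite primesM// inE primes_prime// inE.
rewrite /moebius (perm_all _ perm) (perm_size perm) /= lpm eqxx.
have -> : logn p m = 0%N.
  by apply/eqP; rewrite -leqn0 leqNgt logn_gt0 mem_primes (negPf pm) !andbF.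
rewrite /= (@eq_in_all _ _ (fun q => logn q m == 1%N)).
  by case: ifP => _; rewrite ?oppr0// exprS mulN1r.
move=> q; rewrite mem_primes => /and3P[_ _ qm]; rewrite lpm.
by have [pq|//] := eqVneq p q; rewrite pq qm in pm.
Qed.

(** Let p be a prime divisor of n. A divisor p e contributes - mu(e) if p does not divide e, and 0
    otherwise. The divisors prime to p are the same for n and for n/p, so these terms cancel those
    of the divisors of n prime to p. *)
Lemma sum_moebius {R : realType} (n : nat) : (0 < n)%N ->
  \sum_(1 <= d < n.+1 | (d %| n)%N) moebius d = (n == 1%N)%:R :> R.
Proof.
move=> n0; have [->|n1] := eqVneq n 1%N.
  by rewrite big_mkcond big_nat1/= moebius1.
have pp : prime (pdiv n) by rewrite pdiv_prime//; lia.
set p := pdiv n in pp; have pn : (p %| n)%N by exact: pdiv_dvd.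
have p0 := prime_gt0 pp.
rewrite (bigID (fun d => (p %| d)%N))/=.
rewrite (eq_bigl (fun d => (p %| d) && (d %| n))%N); last by move=> d; rewrite andbC.
rewrite big_mkcondr sum_multiples//=.
rewrite (eq_bigr (fun e =>
  - (if (e %| n %/ p)%N && ~~ (p %| e)%N then moebius e else 0))); last first.
  move=> e _; have [->|e0] := posnP e.
    rewrite muln0 dvd0n eqn0Ngt n0 /= dvd0n eqn0Ngt divn_gt0//.
    by rewrite (dvdn_leq n0 pn) /= oppr0.
  rewrite moebius_primeM// -{1}(divnK pn) [(_ * p)%N in LHS]mulnC dvdn_pmul2l//.
  by case: (e %| _)%N => /=; rewrite ?oppr0//; case: (p %| e)%N; rewrite /= ?oppr0.
rewrite sumrN -big_mkcond/= addrC.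
suff -> : \sum_(1 <= e < (n %/ p).+1 | (e %| n %/ p)%N && ~~ (p %| e)%N) moebius e =
          \sum_(1 <= e < n.+1 | (e %| n)%N && ~~ (p %| e)%N) moebius e :> R by rewrite subrr.
rewrite (@big_nat_widen _ _ _ _ _ n.+1); last by rewrite ltnS leq_div.
apply: eq_bigl => e.
case: (boolP (p %| e)%N) => pe; rewrite ?andbF//= !andbT.
have cop : coprime e p by rewrite coprime_sym prime_coprime.
have -> : (e %| n)%N = (e %| n %/ p)%N by rewrite -[in LHS](divnK pn) Gauss_dvdl.
case: (boolP (e %| _)%N) => //= en; rewrite ltnS dvdn_leq// divn_gt0//.
exact: dvdn_leq.
Qed.

(** * The von Mangoldt function *)

Lemma von_mangoldt_ge0 {R : realType} (n : nat) : 0 <= von_mangoldt n :> R.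
Proof.
rewrite /von_mangoldt; case E : (primes n) => [|p [|? ?]]//.
have : p \in primes n by rewrite E mem_head.
by rewrite mem_primes => /andP[pp _]; rewrite ln_ge0// ler1n prime_gt0.
Qed.

Lemma von_mangoldt_le {R : realType} (n N : nat) : (n <= N)%N ->
  von_mangoldt n <= 1 + ln (N%:R : R).
Proof.
move=> nN; have lnN : 0 <= ln (N%:R : R).
  by case: N {nN} => [|N]; [rewrite ln0|rewrite ln_ge0// ler1n].
rewrite /von_mangoldt; case E : (primes n) => [|p [|? ?]]//; try lra.
have : p \in primes n by rewrite E mem_head.
rewrite mem_primes => /and3P[pp n0 pn]; apply: (@le_trans _ _ (ln (N%:R : R))); last lra.
have pN := leq_trans (dvdn_leq n0 pn) nN; have p0 := prime_gt0 pp.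
by rewrite ler_ln ?posrE ?ltr0n ?ler_nat// (leq_trans p0).
Qed.

(** Strong induction with n = p m: among the divisors of n that do not divide m, only p^(v+1) with v
    the exponent of p in m is a prime power, and it adds log p to log m. *)
Lemma sum_von_mangoldt {R : realType} (n : nat) : (0 < n)%N ->
  \sum_(1 <= d < n.+1 | (d %| n)%N) von_mangoldt d = ln n%:R :> R.
Proof.
elim/ltn_ind: n => n IH n0; have [->|n1] := eqVneq n 1%N.
  by rewrite big_mkcond big_nat1/= ln1 /von_mangoldt.
have pp : prime (pdiv n) by rewrite pdiv_prime//; lia.
set p := pdiv n in pp; have pn : (p %| n)%N by exact: pdiv_dvd.
have p0 := prime_gt0 pp; have p1 := prime_gt1 pp.
pose m := (n %/ p)%N; have nE : n = (p * m)%N by rewrite mulnC divnK.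
have m0 : (0 < m)%N by move: n0; rewrite nE muln_gt0 => /andP[].
have mn : (m < n)%N by rewrite nE ltn_Pmull.
rewrite (bigID (fun d => (d %| m)%N))/=.
rewrite (eq_bigl (fun d => (d %| m)%N)); last first.
  move=> d; rewrite nE; case: (boolP (d %| m)%N) => [dm|_]; last by rewrite andbF.
  by rewrite dvdn_mull.
rewrite sum_divisors_widen ?m0 1?ltnW// IH//.
pose v := logn p m; pose d0 := (p ^ v.+1)%N.
have d0n : (d0 %| n)%N by rewrite nE /d0 expnS dvdn_pmul2l// pfactor_dvdnn.
have d0m : ~~ (d0 %| m)%N by rewrite pfactor_dvdn// ltnn.
have d0N : (d0 <= n)%N by exact: dvdn_leq.
have d01 : (0 < d0)%N by rewrite expn_gt0 p0.
rewrite big_mkcond (bigD1_seq d0) ?iota_uniq ?mem_index_iota ?d01//=.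
rewrite d0n d0m /= von_mangoldt_pfactor// big1 ?addr0.
  by rewrite nE natrM lnM ?posrE ?ltr0n// addrC.
(* A power of p that divides n but not m has exponent exactly v + 1; a power of another prime is
   coprime to p and would divide m. *)
move=> d dd0; case: ifP => // /andP[dn dm]; apply: von_mangoldt_eq0 => q j qq dE.
have [qp|qp] := eqVneq q p.
  have : (p ^ j.+1 %| p ^ (logn p n))%N.
    by rewrite dvdn_Pexp2l// -pfactor_dvdn// -qp -dE.
  rewrite dvdn_Pexp2l// nE lognM// logn_prime// eqxx add1n => jv.
  move: dm; rewrite dE qp pfactor_dvdn// -ltnNge => vj.
  by move: dd0; rewrite dE qp (_ : j = v) ?eqxx// /v; lia.
move: dm; rewrite dE -(@Gauss_dvdr _ p).
  by rewrite -nE -dE dn.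
by rewrite coprimeXl// prime_coprime// dvdn_prime2.
Qed.

(** * The divisor function and harmonic sums *)

Definition num_divisors (n : nat) : nat := size (divisors n).

Lemma num_divisorsE {R : realType} (n N : nat) : (0 < n <= N)%N ->
  (num_divisors n)%:R = \sum_(1 <= d < N.+1 | (d %| n)%N) 1 :> R.
Proof.
move=> /andP[n0 nN]; rewrite -big_filter big_const_seq count_predT iter_addr_0.
congr (_%:R); apply/perm_size/uniq_perm.
- exact: divisors_uniq.
- by rewrite filter_uniq// iota_uniq.
move=> d; rewrite -dvdn_divisors// mem_filter mem_index_iota.
case: (boolP (d %| n)%N) => //= dn.
by rewrite (dvdn_gt0 n0 dn) ltnS (leq_trans (dvdn_leq n0 dn)).
Qed.

(** Every divisor d of a b is the product of gcd(d, a), which divides a, and d / gcd(d, a), which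
    divides b. *)
Lemma num_divisorsM (a b : nat) : (0 < a)%N -> (0 < b)%N ->
  (num_divisors (a * b) <= num_divisors a * num_divisors b)%N.
Proof.
move=> a0 b0; rewrite /num_divisors -(size_allpairs muln).
apply: uniq_leq_size; first exact: divisors_uniq.
move=> d; rewrite -dvdn_divisors ?muln_gt0 ?a0// => dab.
have d0 : (0 < d)%N by apply: dvdn_gt0 dab; rewrite muln_gt0 a0.
have g0 : (0 < gcdn d a)%N by rewrite gcdn_gt0 d0.
apply/allpairsP; exists (gcdn d a, d %/ gcdn d a)%N => /=; split.
- by rewrite -dvdn_divisors// dvdn_gcdr.
- rewrite -dvdn_divisors// -(@Gauss_dvdr _ (a %/ gcdn d a)).
    rewrite -(@dvdn_pmul2l (gcdn d a))// mulnA ![(gcdn d a * _)%N]mulnC.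
    by rewrite !divnK ?dvdn_gcdl ?dvdn_gcdr.
  rewrite /coprime -(@eqn_pmul2l (gcdn d a))// muln1 muln_gcdr.
  by rewrite ![(gcdn d a * _)%N]mulnC !divnK ?dvdn_gcdl ?dvdn_gcdr.
- by rewrite mulnC divnK ?dvdn_gcdl.
Qed.

Definition harmonic_sum {R : realType} (N : nat) : R := \sum_(1 <= n < N.+1) n%:R^-1.

Lemma harmonic_sum_ge0 {R : realType} (N : nat) : 0 <= harmonic_sum N :> R.
Proof. by apply: sumr_ge0 => n _; rewrite invr_ge0 ler0n. Qed.

Lemma le_harmonic_sum {R : realType} (m n : nat) : (m <= n)%N ->
  harmonic_sum m <= harmonic_sum n :> R.
Proof.
move=> mn; rewrite /harmonic_sum [leRHS](@big_cat_nat _ _ _ m.+1)//=.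
by rewrite lerDl sumr_ge0// => i _; rewrite invr_ge0 ler0n.
Qed.

(** The induction step is 1/(N+2) <= ln(N+2) - ln(N+1), from ln(1 + t) <= t at t = -1/(N+2). The
    case N = 0 relies on the convention ln 0 = 0. *)
Lemma harmonic_sum_le {R : realType} (N : nat) :
  harmonic_sum N <= 1 + ln (N%:R : R).
Proof.
case: N => [|N]; first by rewrite /harmonic_sum big_geq// ln0// addr0.
elim: N => [|N IH]; first by rewrite /harmonic_sum big_nat1 invr1 ln1 addr0.
rewrite /harmonic_sum big_nat_recr//= -/(harmonic_sum N.+1).
have := @le_ln1Dx R (- N.+2%:R^-1).
have N2 : 0 < N.+2%:R :> R by rewrite ltr0n.
have -> : 1 - N.+2%:R^-1 = N.+1%:R / N.+2%:R :> R.
  rewrite -{1}(@divff _ N.+2%:R) ?gt_eqF// -[X in _ - X]mul1r -mulrBl.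
  by rewrite -[in X in X - 1]natr1 addrK.
rewrite ln_div ?posrE ?ltr0n// ltrN2 invf_lt1// ltr1n.
move=> /(_ isT) h; apply: le_trans (lerD IH (lexx _)) _.
by rewrite -addrA lerD2l; move: h; move: (ln _) (ln _) (_^-1) => a b c; lra.
Qed.

(** With n = d e, the weight 1/n factors as 1/d times 1/e, and the range e <= N/d is enlarged to e
    <= N. *)
Lemma sum_num_divisors_div {R : realType} (N : nat) :
  \sum_(1 <= n < N.+1) (num_divisors n)%:R / n%:R <= harmonic_sum N ^+ 2 :> R.
Proof.
rewrite (eq_big_nat _ _ (F2 := fun n => \sum_(1 <= d < N.+1 | (d %| n)%N) n%:R^-1)); last first.
  move=> n n1; rewrite (@num_divisorsE _ _ N); last by lia.
  by rewrite mulr_suml; under eq_bigr do rewrite mul1r.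
rewrite (sum_divisors_exchange N (fun _ k => k%:R^-1)) expr2 {2}/harmonic_sum mulrC mulr_suml.
apply: ler_sum_nat => d _; under eq_bigr do rewrite natrM invfM.
rewrite -mulr_sumr ler_wpM2l ?invr_ge0//.
by apply: le_harmonic_sum; exact: leq_div.
Qed.

(* Writing one factor d(n) as a sum over divisors n = d e and using d(de) <= d(d) d(e) bounds the
   sum by the square of the sum of d(n)/n. *)
Lemma sum_sqr_num_divisors_div {R : realType} (N : nat) :
  \sum_(1 <= n < N.+1) (num_divisors n)%:R ^+ 2 / n%:R <= harmonic_sum N ^+ 4 :> R.
Proof.
rewrite (eq_big_nat _ _ (F2 := fun n => \sum_(1 <= d < N.+1 | (d %| n)%N)
   ((num_divisors n)%:R / n%:R))); last first.
  move=> n n1; rewrite expr2 {1}(@num_divisorsE _ _ N); last by lia.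
  by rewrite -mulrA mulr_suml; under eq_bigr do rewrite mul1r.
rewrite (sum_divisors_exchange N (fun _ k => (num_divisors k)%:R / k%:R)).
pose T N : R := \sum_(1 <= n < N.+1) (num_divisors n)%:R / n%:R.
apply: (@le_trans _ _ (T N * T N)).
  rewrite {1}/T mulr_suml; apply: ler_sum_nat => d d1.
  apply: (@le_trans _ _ ((num_divisors d)%:R / d%:R * T (N %/ d)%N)).
    rewrite /T mulr_sumr; apply: ler_sum_nat => e e1.
    rewrite natrM invfM mulrACA ler_wpM2r ?mulr_ge0 ?invr_ge0//.
    by rewrite -natrM ler_nat num_divisorsM//; lia.
  rewrite ler_wpM2l ?divr_ge0//.
  rewrite /T [leRHS](@big_cat_nat _ _ _ (N %/ d).+1)//= ?ltnS ?leq_div//.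
  by rewrite lerDl sumr_ge0// => i _; rewrite divr_ge0.
have T0 : 0 <= T N by apply: sumr_ge0 => i _; rewrite divr_ge0.
by rewrite (exprM _ 2 2) -expr2 lerXn2r ?nnegrE ?exprn_ge0 ?harmonic_sum_ge0// sum_num_divisors_div.
Qed.

(** * Vaughan's identity *)

Definition moebius_trunc {R : realType} (U n : nat) : R :=
  \sum_(1 <= d < U.+1 | (d %| n)%N) moebius d.

Lemma moebius_truncE {R : realType} (U n : nat) : (0 < n <= U)%N ->
  moebius_trunc U n = (n == 1%N)%:R :> R.
Proof.
move=> nU; rewrite /moebius_trunc sum_divisors_widen// sum_moebius//.
by case/andP: nU.
Qed.

Lemma normr_moebius_trunc_le {R : realType} (U n : nat) : (0 < n)%N ->
  `|moebius_trunc U n : R| <= (num_divisors n)%:R.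
Proof.
move=> n0; rewrite (@num_divisorsE _ _ (U + n)); last by rewrite n0 leq_addl.
apply: le_trans (ler_norm_sum _ _ _) _.
apply: (@le_trans _ _ (\sum_(1 <= d < U.+1 | (d %| n)%N) 1)).
  by apply: ler_sum => d _; exact: normr_moebius_le1.
rewrite [leRHS](@big_cat_nat _ _ _ U.+1)//= ?ltnS ?leq_addr//.
by rewrite lerDl sumr_ge0.
Qed.

(** This sum is evaluated in two ways: expanding [moebius_trunc] gives type I sums, splitting the
    range at n = U gives f m plus a type II sum. Weighting by Lambda(m) and comparing yields
    Vaughan's identity. *)
Definition moebius_trunc_sum {R : realType} (f : nat -> R[i]) (U N m : nat) : R[i] :=
  \sum_(1 <= n < (N %/ m).+1) (moebius_trunc U n)%:C%C * f (m * n)%N.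

Lemma vaughan_typeI {R : realType} (f : nat -> R[i]) (U N m : nat) : (0 < m)%N ->
  moebius_trunc_sum f U N m =
  \sum_(1 <= d < U.+1) (moebius d)%:C%C *
    \sum_(1 <= e < (N %/ (m * d)).+1) f (m * d * e)%N.
Proof.
move=> m0; rewrite /moebius_trunc_sum.
under eq_bigr do rewrite rmorph_sum mulr_suml.
rewrite (exchange_big_dep_nat xpredT)//=; apply: eq_big_nat => d /andP[d0 _].
rewrite sum_multiples// divnMA mulr_sumr.
by apply: eq_bigr => e _; rewrite mulnA.
Qed.

(** Over the full range of m, collecting k = m e turns the sum of Lambda over the divisors of k into
    log k. *)
Lemma vaughan_log {R : realType} (f : nat -> R[i]) (U N : nat) :
  \sum_(1 <= m < N.+1) (von_mangoldt m)%:C%C * moebius_trunc_sum f U N m =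
  \sum_(1 <= d < U.+1) (moebius d)%:C%C *
    \sum_(1 <= k < (N %/ d).+1) (ln (k%:R : R))%:C%C * f (d * k)%N.
Proof.
rewrite (eq_big_nat _ _ (F2 := fun m => \sum_(1 <= d < U.+1)
   (moebius d)%:C%C * ((von_mangoldt m)%:C%C *
     \sum_(1 <= e < (N %/ (m * d)).+1) f (m * d * e)%N))); last first.
  move=> m /andP[m0 _]; rewrite vaughan_typeI// mulr_sumr.
  by apply: eq_bigr => d _; rewrite mulrCA.
rewrite exchange_big_nat/=; apply: eq_big_nat => d /andP[d0 _].
rewrite -mulr_sumr; congr (_ * _).
rewrite [RHS](eq_big_nat _ _ (F2 := fun k => \sum_(1 <= m < (N %/ d).+1 | (m %| k)%N)
   (von_mangoldt m)%:C%C * f (d * k)%N)); last first.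
  move=> k /andP[k0 kN]; rewrite -mulr_suml sum_divisors_widen ?k0//.
  by rewrite -sum_von_mangoldt// rmorph_sum.
rewrite (sum_divisors_exchange _ (fun m k => (von_mangoldt m)%:C%C * f (d * k)%N)).
rewrite (@big_cat_nat _ _ _ (N %/ d).+1)/= ?ltnS ?leq_div//.
(* For m > N/d the inner range is empty. *)
rewrite [X in _ + X]big_nat_cond [X in _ + X]big1 ?addr0; last first.
  move=> m /andP[/andP[mN _] _]; rewrite big_geq ?mulr0//.
  by rewrite mulnC divnMA divn_small.
apply: eq_bigr => m _; rewrite mulr_sumr mulnC divnMA.
by apply: eq_bigr => e _; rewrite mulnA.
Qed.

(** [moebius_trunc] is 1 at n = 1 and vanishes for 1 < n <= U, so the head of the sum is just f
    m. *)
Lemma vaughan_typeII {R : realType} (f : nat -> R[i]) (U N m : nat) :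
  (0 < U)%N -> (0 < m <= N)%N ->
  moebius_trunc_sum f U N m =
  f m + \sum_(U.+1 <= n < (N %/ m).+1) (moebius_trunc U n)%:C%C * f (m * n)%N.
Proof.
move=> U0 /andP[m0 mN].
have head K : (0 < K <= U)%N -> \sum_(1 <= n < K.+1) (moebius_trunc U n)%:C%C * f (m * n)%N = f m.
  move=> /andP[K0 KU]; rewrite big_ltn//= moebius_truncE// eqxx muln1 mul1r.
  rewrite big_nat_cond big1 ?addr0// => n /andP[/andP[n1 nK] _].
  rewrite moebius_truncE; last by lia.
  by rewrite (_ : (n == 1%N) = false) ?mul0r//; lia.
have Nm : (0 < N %/ m)%N by rewrite divn_gt0.
have [UNm|NmU] := leqP U (N %/ m); last first.
  rewrite [X in _ + X]big_geq ?addr0 ?ltnS ?(ltnW NmU)//.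
  by rewrite /moebius_trunc_sum head// Nm ltnW.
by rewrite /moebius_trunc_sum (@big_cat_nat _ _ _ U.+1)/= ?ltnS// head ?U0 ?leqnn//.
Qed.

(** The sum of Lambda(m) [moebius_trunc_sum] over all m <= N is the logarithmic sum. Its part m <= U
    is expanded as type I; its part m > U is the wanted sum over m > U plus the bilinear sum. *)
Lemma vaughan_identity {R : realType} (f : nat -> R[i]) (U N : nat) :
  (0 < U <= N)%N ->
  \sum_(1 <= n < N.+1) (von_mangoldt n)%:C%C * f n =
    \sum_(1 <= n < U.+1) (von_mangoldt n)%:C%C * f n
  + \sum_(1 <= d < U.+1) (moebius d)%:C%C *
      \sum_(1 <= k < (N %/ d).+1) (ln (k%:R : R))%:C%C * f (d * k)%N
  - \sum_(1 <= m < U.+1) (von_mangoldt m)%:C%C *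
      \sum_(1 <= d < U.+1) (moebius d)%:C%C * \sum_(1 <= e < (N %/ (m * d)).+1) f (m * d * e)%N
  - \sum_(U.+1 <= n < N.+1) (moebius_trunc U n)%:C%C *
      \sum_(U.+1 <= m < (N %/ U).+1 | (m * n <= N)%N) (von_mangoldt m)%:C%C * f (m * n)%N.
Proof.
move=> /andP[U0 UN].
rewrite -vaughan_log [in RHS](@big_cat_nat _ _ _ U.+1 1 N.+1)//=.
rewrite [LHS](@big_cat_nat _ _ _ U.+1 1 N.+1)//=.
rewrite (@eq_big_nat _ _ _ U.+1 N.+1
  (fun m => (von_mangoldt m)%:C%C * moebius_trunc_sum f U N m)
  (fun m => (von_mangoldt m)%:C%C * f m +
   \sum_(U.+1 <= n < (N %/ m).+1) (von_mangoldt m)%:C%C *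
     ((moebius_trunc U n)%:C%C * f (m * n)%N))); last first.
  by move=> m mN; rewrite vaughan_typeII ?mulrDr ?mulr_sumr//; lia.
rewrite big_split/=.
rewrite [X in _ - X - _](eq_big_nat _ _ (F2 := fun m =>
  (von_mangoldt m)%:C%C * moebius_trunc_sum f U N m)); last first.
  by move=> m /andP[m0 _]; rewrite vaughan_typeI.
rewrite [X in _ + (_ + (_ + X)) - _ - _](_ : _ = \sum_(U.+1 <= n < N.+1)
  (moebius_trunc U n)%:C%C *
    \sum_(U.+1 <= m < (N %/ U).+1 | (m * n <= N)%N) (von_mangoldt m)%:C%C * f (m * n)%N);
  first by ring.
transitivity (\sum_(U.+1 <= m < N.+1) \sum_(U.+1 <= n < N.+1 | (m * n <= N)%N)
   (von_mangoldt m)%:C%C * ((moebius_trunc U n)%:C%C * f (m * n)%N)).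
  apply: eq_big_nat => m /andP[Um _].
  rewrite (@big_nat_widen _ _ _ _ _ N.+1) ?ltnS ?leq_div//.
  by apply: eq_bigl => n /=; rewrite ltnS leq_divRL 1?mulnC//; lia.
rewrite (exchange_big_dep_nat xpredT)//=; apply: eq_big_nat => n /andP[Un nN].
rewrite mulr_sumr [RHS](@big_nat_widen _ _ _ _ _ N.+1) ?ltnS ?leq_div//.
apply: eq_big => [m|m _]; last by rewrite mulrCA.
(* Since n > U, the condition m n <= N already forces m <= N/U. *)
case: (boolP (m * n <= N)%N) => //= mnN; rewrite ltnS leq_divRL//.
by rewrite (leq_trans _ mnN)// leq_mul2l ltnW// orbT.
Qed.

(** * Type I sums *)

Lemma ler_nat_div {R : realType} (N d : nat) : (0 < d)%N -> (N %/ d)%:R <= N%:R / d%:R :> R.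
Proof. by move=> d0; rewrite ler_pdivlMr ?ltr0n// -natrM ler_nat leq_trunc_div. Qed.

(** This is [spaced_sum_le] with weight B N/j, whose harmonic sum produces the logarithm. *)
Lemma sum_spaced_div_le {R : realType} (x delta B : R) (r N J : nat) (E : nat -> R) :
  (0 < r)%N -> 0 < delta ->
  (forall j, (0 < j <= r)%N -> delta <= dist_int (j%:R * x)) -> 0 <= B ->
  (J <= N)%N ->
  (forall j, (0 < j <= J)%N -> 0 <= E j <= B * (N%:R / j%:R)) ->
  (forall j, (0 < j <= J)%N -> E j * dist_int (j%:R * x) <= B) ->
  \sum_(1 <= j < J.+1) E j <=
    B * (N%:R * (1 + ln (N%:R : R)) / r%:R + 2 * J%:R / delta).
Proof.
move=> r0 d0 sep B0 JN E1 E2.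
apply: le_trans (@spaced_sum_le R x delta B r J (fun j => B * (N%:R / j%:R)) E r0 d0 sep
  _ _ E1 E2) _.
- move=> i j ij; rewrite ler_wpM2l// ler_wpM2l// lef_pV2 ?posrE ?ltr0n ?ler_nat; lia.
- by move=> j _; rewrite mulr_ge0// divr_ge0.
rewrite -mulr_sumr -mulr_sumr -/(harmonic_sum J).
have hL : harmonic_sum J <= 1 + ln (N%:R : R).
  exact: le_trans (le_harmonic_sum _ _ JN) (harmonic_sum_le N).
rewrite mulrDr lerD//.
  by rewrite mulrC -!mulrA ler_wpM2l// ler_wpM2l// ler_wpM2r// invr_ge0.
by rewrite [_ * B]mulrC !mulrA.
Qed.

(** The weights log k increase, so partial summation bounds the inner sum over k by the logarithm
    times both N/d and the inverse of the distance of d x to the integers. *)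
Lemma moebius_log_sum_le {R : realType} (x delta : R) (r U N : nat) :
  (0 < r)%N -> 0 < delta ->
  (forall j, (0 < j <= r)%N -> delta <= dist_int (j%:R * x)) ->
  (0 < U <= N)%N ->
  normc (\sum_(1 <= d < U.+1) (moebius d)%:C%C *
     \sum_(1 <= k < (N %/ d).+1) (ln (k%:R : R))%:C%C * expi ((d * k)%:R * x)) <=
  (1 + ln (N%:R : R)) * (N%:R * (1 + ln (N%:R : R)) / r%:R + 2 * U%:R / delta).
Proof.
move=> r0 d0 sep /andP[U0 UN]; set L := 1 + ln _.
have L0 : 0 <= L by rewrite addr_ge0// ln_ge0// ler1n; lia.
pose E d := normc (\sum_(1 <= k < (N %/ d).+1) (ln (k%:R : R))%:C%C * expi (k%:R * (d%:R * x))).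
apply: (@le_trans _ _ (\sum_(1 <= d < U.+1) E d)).
  apply: le_trans (normc_sum _ _ _ _) _; apply: ler_sum => d _.
  rewrite Normc.normcM normc_real /E.
  under eq_bigr do rewrite natrM [_%:R * _]mulrC -mulrA.
  by rewrite -[leRHS]mul1r ler_wpM2r ?normc_ge0// normr_moebius_le1.
have Ed d : (0 < d <= U)%N -> E d <= L * (N %/ d)%:R /\ E d * dist_int (d%:R * x) <= L.
  move=> dU; rewrite -{1}[(N %/ d)%N](subn1 (N %/ d).+1).
  apply: normc_weighted_expi_sum => //.
    move=> i j ij jN; rewrite ler_ln ?posrE ?ltr0n ?ler_nat; lia.
  move=> i /andP[i1 iN]; rewrite ln_ge0 ?ler1n//=.
  have : ln (i%:R : R) <= ln N%:R.
    rewrite ler_ln ?posrE ?ltr0n ?ler_nat//; first exact: leq_trans (ltnSE iN) (leq_div _ _).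
    by lia.
  by rewrite /L; lra.
apply: (@sum_spaced_div_le R x delta L r N U E r0 d0 sep) => //.
- move=> d dU; rewrite normc_ge0 /=; apply: le_trans (Ed d dU).1 _.
  by rewrite ler_wpM2l// ler_nat_div//; lia.
- by move=> d dU; exact: (Ed d dU).2.
Qed.

Lemma mangoldt_moebius_sum_le {R : realType} (x delta : R) (r U N : nat) :
  (0 < r)%N -> 0 < delta ->
  (forall j, (0 < j <= r)%N -> delta <= dist_int (j%:R * x)) ->
  (0 < U)%N -> (U ^ 2 <= N)%N ->
  normc (\sum_(1 <= m < U.+1) (von_mangoldt m)%:C%C * \sum_(1 <= d < U.+1) (moebius d)%:C%C *
     \sum_(1 <= e < (N %/ (m * d)).+1) expi ((m * d * e)%:R * x)) <=
  (1 + ln (N%:R : R)) * (N%:R * (1 + ln (N%:R : R)) / r%:R + 2 * (U ^ 2)%:R / delta).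
Proof.
move=> r0 d0 sep U0 UN; set L := 1 + ln _.
have N0 : (0 < N)%N by apply: leq_trans UN; rewrite expn_gt0 U0.
have L1 : 1 <= L by rewrite lerDl ln_ge0// ler1n.
pose E j := normc (\sum_(1 <= e < (N %/ j).+1) expi (e%:R * (j%:R * x))).
have E0 j : 0 <= E j by exact: normc_ge0.
apply: (@le_trans _ _ (\sum_(1 <= m < U.+1) von_mangoldt m * \sum_(1 <= d < U.+1) E (m * d)%N)).
  apply: le_trans (normc_sum _ _ _ _) _; apply: ler_sum => m _.
  rewrite Normc.normcM normc_real ger0_norm ?von_mangoldt_ge0// ler_wpM2l ?von_mangoldt_ge0//.
  apply: le_trans (normc_sum _ _ _ _) _; apply: ler_sum => d _.
  rewrite Normc.normcM normc_real /E.
  under eq_bigr do rewrite natrM [_%:R * _]mulrC -mulrA.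
  by rewrite -[leRHS]mul1r ler_wpM2r ?normc_ge0// normr_moebius_le1.
(* By positivity the square m, d <= U may be enlarged to the hyperbolic region m d <= U^2.
   Collecting k = m d then gives the weight log k. *)
apply: (@le_trans _ _ (\sum_(1 <= m < (U ^ 2).+1) \sum_(1 <= d < (U ^ 2 %/ m).+1)
   von_mangoldt m * E (m * d)%N)).
  have UU : (U <= U ^ 2)%N by rewrite -mulnn leq_pmulr.
  rewrite [leRHS](@big_cat_nat _ _ _ U.+1)//=; apply: ler_wpDr.
    by apply: sumr_ge0 => m _; apply: sumr_ge0 => d _; rewrite mulr_ge0// von_mangoldt_ge0.
  apply: ler_sum_nat => m /andP[m0 mU]; rewrite mulr_sumr.
  rewrite [leRHS](@big_cat_nat _ _ _ U.+1)//=; last first.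
    by rewrite ltnS leq_divRL// -mulnn leq_mul2l -ltnS mU orbT.
  apply: ler_wpDr => //.
  by apply: sumr_ge0 => d _; rewrite mulr_ge0// von_mangoldt_ge0.
rewrite -(sum_divisors_exchange _ (fun m k => von_mangoldt m * E k)).
apply: (@le_trans _ _ (L * \sum_(1 <= k < (U ^ 2).+1) E k)).
  rewrite mulr_sumr; apply: ler_sum_nat => k /andP[k0 kU].
  rewrite -mulr_suml ler_wpM2r// sum_divisors_widen ?k0// sum_von_mangoldt//.
  have : ln (k%:R : R) <= ln N%:R.
    by rewrite ler_ln ?posrE ?ltr0n ?ler_nat// (leq_trans _ UN).
  by rewrite /L; lra.
rewrite ler_wpM2l ?(le_trans ler01 L1)//.
rewrite -[leRHS]mul1r.
apply: (@sum_spaced_div_le R x delta 1 r N (U ^ 2) E r0 d0 sep) => // j /andP[j0 _].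
  rewrite E0 mul1r /=; apply: le_trans (normc_expi_sum _ _ _) _.
  by rewrite subn1 ler_nat_div.
exact: normc_expi_geom.
Qed.

(** * Type II sums *)

Lemma sqr_normcE {R : realType} (z : R[i]) : (normc z ^+ 2)%:C%C = z * z^*%C.
Proof. by rewrite rmorphXn; exact: sqr_normc. Qed.

Lemma normc_conj {R : realType} (z : R[i]) : normc z^*%C = normc z.
Proof. by case: z => a b; rewrite /= sqrrN. Qed.

Lemma conjc_scale_expi {R : realType} (c x : R) :
  (c%:C%C * expi x)^*%C = c%:C%C * expi (- x).
Proof.
apply/eqP; rewrite eq_complex /= mulrN cosN sinN.
by apply/andP; split; apply/eqP; ring.
Qed.

Lemma ler_sum_symmetric {R : realType} (F : nat -> nat -> R) (a b : nat) :
  (forall i j, 0 <= F i j) -> (forall i j, F i j = F j i) ->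
  \sum_(a <= i < b) \sum_(a <= j < b) F i j <=
  2 * \sum_(a <= i < b) \sum_(a <= j < b | (j <= i)%N) F i j.
Proof.
move=> F0 FC.
under eq_bigr => i _ do rewrite (bigID (fun j => (j <= i)%N))/=.
rewrite big_split/= mulrDl mul1r lerD2l.
rewrite (exchange_big_dep_nat xpredT)//=; apply: ler_sum => j _.
rewrite [leRHS]big_mkcond [leLHS]big_mkcond/=; apply: ler_sum => i _.
by rewrite -ltnNge FC; case: ltngtP.
Qed.

Lemma ler_sum_subinterval {R : realType} (F : nat -> R) (a b : nat) :
  (forall i, 0 <= F i) -> \sum_(a <= i < b) F i <= \sum_(0 <= i < b) F i.
Proof.
move=> F0; rewrite (@big_nat_widenl _ _ _ a 0)//= big_mkcond/=.
by apply: ler_sum => i _; case: ifP.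
Qed.

(** The correlation of the terms m and m - k of the bilinear inner sum: the larger index m fixes the
    range of n, and the coefficient n is the weight put into Cauchy-Schwarz. *)
Definition linear_weight_sum {R : realType} (x : R) (U N m k : nat) : R[i] :=
  \sum_(U.+1 <= n < (N %/ m).+1) (n%:R : R)%:C%C * expi (n%:R * (k%:R * x)).

Lemma linear_weight_sum_le {R : realType} (x : R) (U N m k : nat) : (0 < m)%N ->
  normc (linear_weight_sum x U N m k) <= (N%:R / m%:R) ^+ 2 /\
  normc (linear_weight_sum x U N m k) * dist_int (k%:R * x) <= N%:R / m%:R.
Proof.
move=> m0; have Nm0 : 0 <= N%:R / m%:R :> R by rewrite divr_ge0.
have [h1 h2] := @normc_weighted_expi_sum R (k%:R * x) (fun n => n%:R) U.+1 (N %/ m).+1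
  (N%:R / m%:R) ltac:(by move=> i j /andP[_ ij] _; rewrite ler_nat)
  ltac:(by move=> i /andP[_ iN]; rewrite ler0n (le_trans _ (ler_nat_div N m m0))// ler_nat)
  Nm0.
split=> //; apply: le_trans h1 _; rewrite expr2 ler_wpM2l// subSS.
by apply: le_trans (ler_nat_div N m m0); rewrite ler_nat leq_subr.
Qed.

(** The diagonal k = 0 takes the trivial bound; the other k fall under [spaced_sum_le] with constant
    weight (N/m)^2 and B = N/m. *)
Lemma sum_linear_weight_sum_le {R : realType} (x delta : R) (r U N m : nat) :
  (0 < r)%N -> 0 < delta ->
  (forall j, (0 < j <= r)%N -> delta <= dist_int (j%:R * x)) -> (0 < m)%N ->
  \sum_(0 <= k < m.+1) normc (linear_weight_sum x U N m k) <=
    (N%:R / m%:R) ^+ 2 + N%:R ^+ 2 / r%:R / m%:R + 2 * N%:R / delta.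
Proof.
move=> r0 d0 sep m0; have mR : m%:R != 0 :> R by rewrite pnatr_eq0; lia.
have rR : r%:R != 0 :> R by rewrite pnatr_eq0; lia.
rewrite big_ltn// -addrA lerD//; first exact: (linear_weight_sum_le _ _ _ _ _ m0).1.
apply: le_trans (@spaced_sum_le R x delta (N%:R / m%:R) r m (fun=> (N%:R / m%:R) ^+ 2) _
  r0 d0 sep _ _ _ _) _ => //.
- by move=> k _; rewrite normc_ge0 (linear_weight_sum_le _ _ _ _ _ m0).1.
- by move=> k _; rewrite (linear_weight_sum_le _ _ _ _ _ m0).2.
rewrite sumr_const_nat subn1 -mulr_natr /=.
rewrite le_eqVlt; apply/orP; left; apply/eqP; field.
by rewrite mR rR gt_eqF.
Qed.

Definition bilinear_inner {R : realType} (x : R) (U N n : nat) : R[i] :=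
  \sum_(U.+1 <= m < (N %/ U).+1 | (m * n <= N)%N) (von_mangoldt m)%:C%C * expi ((m * n)%:R * x).

Definition bilinear_corr {R : realType} (x : R) (U N m m' : nat) : R[i] :=
  \sum_(U.+1 <= n < N.+1 | (m * n <= N)%N && (m' * n <= N)%N)
     (n%:R : R)%:C%C * expi (n%:R * (m%:R * x - m'%:R * x)).

Lemma bilinear_corrC {R : realType} (x : R) (U N m m' : nat) :
  normc (bilinear_corr x U N m m') = normc (bilinear_corr x U N m' m).
Proof.
rewrite -normc_conj /bilinear_corr rmorph_sum; congr normc.
apply: eq_big => [n|n _]; first exact: andbC.
by apply: (etrans (conjc_scale_expi _ _)); rewrite -mulrN opprB.
Qed.

Lemma bilinear_corrE {R : realType} (x : R) (U N m m' : nat) : (0 < m)%N -> (m' <= m)%N ->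
  bilinear_corr x U N m m' = linear_weight_sum x U N m (m - m').
Proof.
move=> m0 mm; rewrite /linear_weight_sum (@big_nat_widen _ _ _ _ _ N.+1) ?ltnS ?leq_div//.
apply: eq_big => [n|n _]; last by rewrite natrB// mulrBl.
rewrite /= ltnS leq_divRL// [(n * m)%N]mulnC; case: (boolP (m * n <= N)%N) => //= h.
by rewrite (leq_trans _ h)// leq_mul2r mm orbT.
Qed.

Lemma sum_sqr_bilinear_inner {R : realType} (x : R) (U N : nat) :
  (\sum_(U.+1 <= n < N.+1) n%:R * normc (bilinear_inner x U N n) ^+ 2)%:C%C =
  \sum_(U.+1 <= m < (N %/ U).+1) \sum_(U.+1 <= m' < (N %/ U).+1)
    (von_mangoldt m * von_mangoldt m')%:C%C * bilinear_corr x U N m m'.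
Proof.
rewrite rmorph_sum /=.
transitivity (\sum_(U.+1 <= n < N.+1) \sum_(U.+1 <= m < (N %/ U).+1 | (m * n <= N)%N)
  \sum_(U.+1 <= m' < (N %/ U).+1 | (m' * n <= N)%N)
    (von_mangoldt m * von_mangoldt m')%:C%C *
    ((n%:R : R)%:C%C * expi (n%:R * (m%:R * x - m'%:R * x)))).
  apply: eq_bigr => n _; rewrite rmorphM [X in _ * X]sqr_normcE.
  have -> : (bilinear_inner x U N n)^*%C = \sum_(U.+1 <= m < (N %/ U).+1 | (m * n <= N)%N)
      (von_mangoldt m)%:C%C * expi (- ((m * n)%:R * x)).
    by rewrite rmorph_sum; apply: eq_bigr => m _; exact: conjc_scale_expi.
  rewrite /bilinear_inner mulr_suml mulr_sumr; apply: eq_bigr => m _.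
  rewrite mulr_sumr mulr_sumr; apply: eq_bigr => m' _.
  rewrite [(von_mangoldt m * _)%:C%C]rmorphM !natrM.
  have -> : n%:R * (m%:R * x - m'%:R * x) = m%:R * n%:R * x + - (m'%:R * n%:R * x) by ring.
  by rewrite expiD; ring.
rewrite (exchange_big_dep_nat xpredT)//=; apply: eq_bigr => m _.
rewrite (exchange_big_dep_nat xpredT)//=; apply: eq_bigr => m' _.
by rewrite -mulr_sumr.
Qed.

(** After opening the square, each Lambda is bounded by the logarithm, symmetry reduces to m' <= m
    at the cost of a factor 2, and for fixed m the shifts m - m' are summed by
    [sum_linear_weight_sum_le]. *)
Lemma sum_sqr_bilinear_inner_le {R : realType} (x delta : R) (r U N : nat) :
  (0 < r)%N -> 0 < delta ->
  (forall j, (0 < j <= r)%N -> delta <= dist_int (j%:R * x)) ->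
  (0 < U <= N)%N ->
  \sum_(U.+1 <= n < N.+1) n%:R * normc (bilinear_inner x U N n) ^+ 2 <=
  2 * (1 + ln (N%:R : R)) ^+ 2 * N%:R ^+ 2 *
    ((1 + ln (N%:R : R)) * (U%:R^-1 + r%:R^-1) + 2 / (U%:R * delta)).
Proof.
move=> r0 d0 sep /andP[U0 UN]; set L := 1 + ln _.
have N0 : (0 < N)%N by exact: leq_trans UN.
have L1 : 1 <= L by rewrite lerDl ln_ge0// ler1n.
set Y := \sum_(_ <= _ < _) _.
have Y0 : 0 <= Y by apply: sumr_ge0 => n _; rewrite mulr_ge0// sqr_ge0.
pose W := (N %/ U)%N.
have UR : 0 < U%:R :> R by rewrite ltr0n.
have step1 : Y <= L ^+ 2 * \sum_(U.+1 <= m < W.+1) \sum_(U.+1 <= m' < W.+1)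
    normc (bilinear_corr x U N m m').
  rewrite -[leLHS]ger0_norm// -normc_real sum_sqr_bilinear_inner.
  apply: le_trans (normc_sum _ _ _ _) _; rewrite mulr_sumr; apply: ler_sum_nat => m /andP[_ mW].
  apply: le_trans (normc_sum _ _ _ _) _; rewrite mulr_sumr; apply: ler_sum_nat => m' /andP[_ mW'].
  rewrite Normc.normcM ler_wpM2r ?normc_ge0// normc_real ger0_norm ?mulr_ge0 ?von_mangoldt_ge0//.
  rewrite expr2 ler_pM ?von_mangoldt_ge0//; apply: von_mangoldt_le; apply: leq_trans (leq_div N U).
    by rewrite -ltnS.
  by rewrite -ltnS.
apply: le_trans step1 _.
rewrite [leRHS](_ : _ = L ^+ 2 * (2 * (N%:R ^+ 2 *
    ((L * (U%:R^-1 + r%:R^-1) + 2 / (U%:R * delta)))))); last by ring.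
rewrite ler_wpM2l ?sqr_ge0//.
apply: le_trans (ler_sum_symmetric _ _ _ _ _) _.
- by move=> *; exact: normc_ge0.
- by move=> *; exact: bilinear_corrC.
rewrite ler_wpM2l//.
apply: (@le_trans _ _ (\sum_(U.+1 <= m < W.+1)
   (N%:R ^+ 2 * (U%:R^-1 + r%:R^-1) * m%:R^-1 + 2 * N%:R / delta))).
  apply: ler_sum_nat => m /andP[Um mW]; have m0 : (0 < m)%N by exact: leq_trans Um.
  apply: (@le_trans _ _ (\sum_(0 <= k < m.+1) normc (linear_weight_sum x U N m k))).
    (* Reversal substitutes k = m - m'. *)
    rewrite [leRHS]big_nat_rev/= add0n.
    apply: le_trans (ler_sum_subinterval _ U.+1 _ _); last by move=> i; exact: normc_ge0.
    rewrite [leRHS](@big_nat_widen _ _ _ _ _ W.+1)//=.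
    under eq_bigl do rewrite -ltnS.
    rewrite le_eqVlt; apply/orP; left; apply/eqP; apply: eq_bigr => j jm.
    by rewrite bilinear_corrE// subSS.
  apply: le_trans (sum_linear_weight_sum_le _ _ _ _ _ _ r0 d0 sep m0) _.
  (* One factor 1/m of (N/m)^2 is replaced by 1/U because m > U; the other is kept for the harmonic
     sum. *)
  rewrite lerD2r mulrDr mulrDl lerD2r exprMn expr2 -!mulrA ler_wpM2l// ler_wpM2l//.
  rewrite expr2 ler_wpM2r ?invr_ge0// lef_pV2 ?posrE ?ltr0n// ler_nat ltnW//.
rewrite big_split/= -mulr_sumr sumr_const_nat subSS -[_ *+ (W - U)]mulr_natr.
rewrite [leRHS]mulrDr lerD//.
  rewrite -mulrA ler_wpM2l ?sqr_ge0// [leLHS]mulrC ler_wpM2r ?addr_ge0 ?invr_ge0//.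
  apply: le_trans (harmonic_sum_le N); apply: le_trans (le_harmonic_sum _ _ (leq_div N U)).
  rewrite /harmonic_sum (@big_nat_widenl _ _ _ U.+1 1)//= big_mkcond/=.
  by apply: ler_sum => i _; case: ifP => // _; rewrite invr_ge0.
have -> : N%:R ^+ 2 * (2 / (U%:R * delta)) = 2 * N%:R / delta * (N%:R / U%:R).
  by field; rewrite !gt_eqF.
rewrite ler_wpM2l ?divr_ge0 ?mulr_ge0//; first exact: ltW.
by apply: le_trans (ler_nat_div N U U0); rewrite ler_nat leq_subr.
Qed.

(** * Exponential sums over primes and progressions *)

(** The difference of the two sides is (l g - n y)^2 / (2 l n). *)
Lemma amgm_weighted {R : realType} (l n g y : R) : 0 < l -> 0 < n ->
  g * y <= (l * (g ^+ 2 / n) + n * y ^+ 2 / l) / 2.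
Proof.
move=> l0 n0; rewrite -subr_ge0.
have -> : (l * (g ^+ 2 / n) + n * y ^+ 2 / l) / 2 - g * y =
  (l * g - n * y) ^+ 2 / (2 * l * n) by field; rewrite !gt_eqF.
by rewrite divr_ge0 ?sqr_ge0// !mulr_ge0// ltW.
Qed.

Lemma bilinear_sum_le {R : realType} (x delta : R) (s U N : nat) :
  (0 < s)%N -> 0 < delta ->
  (forall j, (0 < j <= s ^ 2)%N -> delta <= dist_int (j%:R * x)) ->
  (0 < U <= N)%N -> (s ^ 2)%:R <= delta * U%:R -> delta <= 1 ->
  normc (\sum_(U.+1 <= n < N.+1) (moebius_trunc U n)%:C%C * bilinear_inner x U N n) <=
  5 * (1 + ln (N%:R : R)) ^+ 4 * (N%:R / s%:R).
Proof.
move=> s0 d0 sep UN rU d1; have r0 : (0 < s ^ 2)%N by rewrite expn_gt0 s0.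
have := sum_sqr_bilinear_inner_le x delta _ U N r0 d0 sep UN.
case/andP: UN => U0 UN; have N0 := leq_trans U0 UN.
set L := 1 + ln _; set Y := \sum_(_ <= _ < _) _ => Yle.
have L1 : 1 <= L by rewrite lerDl ln_ge0// ler1n.
have UR : 0 < U%:R :> R by rewrite ltr0n.
have NR : 0 < N%:R :> R by rewrite ltr0n.
have sR : 0 < s%:R :> R by rewrite ltr0n.
have rR : 0 < (s ^ 2)%:R :> R by rewrite ltr0n.
have h1 : (U%:R * delta)^-1 <= (s ^ 2)%:R^-1.
  by rewrite lef_pV2 ?posrE ?mulr_gt0// mulrC.
have h2 : U%:R^-1 <= (s ^ 2)%:R^-1 :> R.
  by rewrite lef_pV2 ?posrE//; nra.
(* From s^2 <= delta U and delta <= 1, both 1/U and 1/(U delta) are at most 1/s^2. *)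
have Yle' : Y <= 8 * L ^+ 3 * N%:R ^+ 2 / (s ^ 2)%:R.
  apply: le_trans Yle _.
  rewrite [leRHS](_ : _ = 2 * L ^+ 2 * N%:R ^+ 2 * (4 * L * (s ^ 2)%:R^-1)); last by ring.
  rewrite ler_wpM2l ?mulr_ge0 ?sqr_ge0 ?(le_trans ler01 L1)//.
  have i0 : 0 < (s ^ 2)%:R^-1 :> R by rewrite invr_gt0.
  by move: i0 h1 h2; move: (_^-1) (_^-1) (_^-1) => u v w; nra.
have l0 : 0 < N%:R / s%:R :> R by rewrite divr_gt0.
(* This parameter balances the two halves: they become L^4 l / 2 and 4 L^3 l. The saving s^2 in the
   mean square thus gives a saving s. *)
set l := N%:R / s%:R in l0 *.
apply: le_trans (normc_sum _ _ _ _) _.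
apply: (@le_trans _ _ (\sum_(U.+1 <= n < N.+1)
   (l / 2 * ((num_divisors n)%:R ^+ 2 / n%:R) +
    (2 * l)^-1 * (n%:R * normc (bilinear_inner x U N n) ^+ 2)))).
  apply: ler_sum_nat => n /andP[Un _]; have n0 : (0 < n)%N by exact: leq_trans Un.
  have nR : 0 < n%:R :> R by rewrite ltr0n.
  rewrite Normc.normcM normc_real.
  apply: (@le_trans _ _ ((num_divisors n)%:R * normc (bilinear_inner x U N n))).
    by rewrite ler_wpM2r ?normc_ge0// normr_moebius_trunc_le.
  apply: le_trans (@amgm_weighted R l n%:R _ _ l0 nR) _.
  rewrite le_eqVlt; apply/orP; left; apply/eqP; field.
  by rewrite !gt_eqF.
rewrite big_split/= -!mulr_sumr -/Y.
have D4 : \sum_(U.+1 <= n < N.+1) (num_divisors n)%:R ^+ 2 / n%:R <= L ^+ 4.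
  apply: (@le_trans _ _ (harmonic_sum N ^+ 4)).
    apply: le_trans (sum_sqr_num_divisors_div N).
    rewrite (@big_nat_widenl _ _ _ U.+1 1)//= big_mkcond/=.
    by apply: ler_sum => i _; case: ifP => // _; rewrite divr_ge0// sqr_ge0.
  rewrite lerXn2r ?nnegrE ?harmonic_sum_ge0 ?harmonic_sum_le//.
  exact: le_trans L1.
apply: (@le_trans _ _ (l / 2 * L ^+ 4 + (2 * l)^-1 * (8 * L ^+ 3 * N%:R ^+ 2 / (s ^ 2)%:R))).
  by rewrite lerD// ler_wpM2l// ?divr_ge0 ?invr_ge0 ?mulr_ge0// ltW.
have -> : (2 * l)^-1 * (8 * L ^+ 3 * N%:R ^+ 2 / (s ^ 2)%:R) = 4 * L ^+ 3 * l.
  by rewrite /l natrX; field; rewrite !gt_eqF.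
have L3 : L ^+ 3 <= L ^+ 4 by rewrite ler_weXn2l.
have L40 : 0 <= L ^+ 4 by rewrite exprn_ge0// (le_trans ler01).
nra.
Qed.

Lemma mangoldt_expi_sum_le {R : realType} (x delta : R) (s U N : nat) :
  (0 < s)%N -> 0 < delta ->
  (forall j, (0 < j <= s ^ 2)%N -> delta <= dist_int (j%:R * x)) ->
  (0 < U)%N -> (U ^ 3 <= N)%N -> (s ^ 2)%:R <= delta * U%:R ->
  normc (\sum_(1 <= n < N.+1) (von_mangoldt n)%:C%C * expi (n%:R * x)) <=
  12 * (1 + ln (N%:R : R)) ^+ 4 * (N%:R / s%:R).
Proof.
move=> s0 d0 sep U0 U3 rU.
have r0 : (0 < s ^ 2)%N by rewrite expn_gt0 s0.
have d1 : delta <= 1.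
  apply: le_trans (sep 1%N _) _ => //.
  by have [z ->] := dist_int_min (1%:R * x); move/le_trans; apply; lra.
have U2 : (U ^ 2 <= N)%N by apply: leq_trans U3; rewrite leq_pexp2l.
have UN : (U <= N)%N by apply: leq_trans U2; rewrite -mulnn leq_pmulr.
have N0 := leq_trans U0 UN.
rewrite (@vaughan_identity R (fun n => expi (n%:R * x)) U N) ?U0//.
have UR : 0 < U%:R :> R by rewrite ltr0n.
have NR : 0 < N%:R :> R by rewrite ltr0n.
have sR : 1 <= s%:R :> R by rewrite ler1n.
have rR : 0 < (s ^ 2)%:R :> R by rewrite ltr0n.
set L := 1 + ln _.
have L1 : 1 <= L by rewrite lerDl ln_ge0// ler1n.
have sr : N%:R / (s ^ 2)%:R <= N%:R / s%:R :> R.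
  rewrite ler_wpM2l// lef_pV2 ?posrE ?ltr0n// ler_nat -mulnn leq_pmulr//.
set B := N%:R / s%:R in sr *.
have B0 : 0 <= B by rewrite divr_ge0.
have dV : delta^-1 <= U%:R / (s ^ 2)%:R.
  by rewrite ler_pdivlMr// mulrC ler_pdivrMr// mulrC.
(* Here s^2 U <= delta U^2 <= U^2 <= N. *)
have NB : U%:R <= B.
  apply: le_trans sr; rewrite ler_pdivlMr//.
  have : U%:R ^+ 2 <= N%:R :> R by rewrite -natrX ler_nat.
  rewrite expr2; nra.
have S0 : normc (\sum_(1 <= n < U.+1) (von_mangoldt n)%:C%C * expi (n%:R * x)) <= L * B.
  apply: le_trans (normc_sum _ _ _ _) _.
  apply: (@le_trans _ _ (\sum_(1 <= n < U.+1) L)).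
    apply: ler_sum_nat => n /andP[_ nU].
    rewrite Normc.normcM normc_expi mulr1 normc_real ger0_norm ?von_mangoldt_ge0//.
    by apply: von_mangoldt_le; exact: leq_trans (ltnSE nU) UN.
  by rewrite sumr_const_nat subn1 -mulr_natr ler_wpM2l//; lra.
(* Since 1/delta <= U/s^2, the condition K U <= N gives K/delta <= N/s^2. It is applied with K = U
   and K = U^2, the latter by U^3 <= N. *)
have typeI (K : nat) : (K * U <= N)%N ->
    L * (N%:R * L / (s ^ 2)%:R + 2 * K%:R / delta) <= 3 * L ^+ 2 * B.
  move=> KU.
  have h : K%:R / delta <= B.
    apply: (@le_trans _ _ (K%:R * (U%:R / (s ^ 2)%:R))); first by rewrite ler_wpM2l.
    apply: le_trans sr; rewrite mulrA ler_wpM2r ?invr_ge0 ?(ltW rR)//.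
    by rewrite -natrM ler_nat.
  have -> : N%:R * L / (s ^ 2)%:R = N%:R / (s ^ 2)%:R * L by rewrite mulrAC.
  rewrite -[2 * _ / delta]mulrA expr2.
  have := ler_wpM2r (le_trans ler01 L1) sr; move: h.
  have BL : B <= B * L by rewrite ler_peMr.
  have -> : 3 * (L * L) * B = L * (3 * (B * L)) by ring.
  move=> h1 h2; rewrite ler_wpM2l ?(le_trans ler01 L1)//; lra.
have S1 := le_trans (moebius_log_sum_le x delta _ U N r0 d0 sep ltac:(by rewrite U0 UN))
  (typeI U ltac:(by rewrite mulnn)).
have S2 := le_trans (mangoldt_moebius_sum_le x delta _ U N r0 d0 sep U0 U2)
  (typeI (U ^ 2)%N ltac:(by rewrite -expnSr)).
have S3 := bilinear_sum_le x delta s U N s0 d0 sep ltac:(by rewrite U0 UN) rU d1.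
rewrite -/L -/B in S1 S2 S3.
apply: le_trans (le_normcD _ _) _; rewrite normcN.
apply: le_trans (lerD (le_normcD _ _) S3) _; rewrite normcN.
apply: le_trans (lerD (lerD (le_normcD _ _) S2) (lexx _)) _.
apply: le_trans (lerD (lerD (lerD S0 S1) (lexx _)) (lexx _)) _.
have L2 : L ^+ 2 <= L ^+ 4 by rewrite ler_weXn2l.
have L4 : L <= L ^+ 4 by rewrite -{1}[L]expr1 ler_weXn2l.
nra.
Qed.

(** * Additive characters modulo q *)

Lemma dist_int_frac_gt0 {R : realType} (a b q : nat) :
  (a < q)%N -> (b < q)%N -> a != b -> 0 < dist_int ((b%:R - a%:R) / q%:R : R).
Proof.
move=> aq bq ab; rewrite lt_neqAle dist_int_ge0 andbT eq_sym.
have q0 : (0 < q)%N by exact: leq_trans aq.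
have [z -> _] := dist_int_min ((b%:R - a%:R) / q%:R : R).
have qR : q%:R != 0 :> R by rewrite pnatr_eq0 -lt0n.
rewrite normr_eq0 subr_eq0; apply/eqP => h.
have : b%:R - a%:R = z%:~R * q%:R :> R by rewrite -h divfK.
rewrite -[b%:R]/(b%:Z%:~R) -[a%:R]/(a%:Z%:~R) -[q%:R]/(q%:Z%:~R) -intrB -intrM.
move/eqP; rewrite eqr_int => /eqP {}h; move/eqP: ab; apply.
have /orP[/orP[z1|/eqP z0]|z1] : (z <= -1) || (z == 0) || (1 <= z) by lia.
- nia.
- by move: h; rewrite z0; lia.
- nia.
Qed.

(** For a different from b the ratio e((b - a)/q) is not 1, while its q-th power e(b - a) is 1, so
    the geometric sum vanishes. *)
Lemma sum_expi_frac {R : realType} (a b q : nat) : (a < q)%N -> (b < q)%N ->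
  \sum_(0 <= h < q) expi (h%:R * ((b%:R - a%:R) / q%:R : R)) = (if b == a then q%:R else 0).
Proof.
move=> aq bq; case: eqVneq => [->|ba].
  under eq_bigr do rewrite subrr mul0r mulr0 expi0.
  by rewrite sumr_const_nat subn0.
have q0 : (0 < q)%N by exact: leq_trans aq.
have := @dist_int_frac_gt0 R a b q aq bq; rewrite eq_sym ba => /(_ isT).
set y := _ / _ => y0.
have z1 : expi y - 1 != 0.
  apply/eqP => h; have := normcB1_expi y; rewrite h Normc.normc0; lra.
apply: (mulfI z1); rewrite mulr0.
under eq_bigr do rewrite expiMn.
rewrite big_mkord -subrX1 -expiMn.
have -> : q%:R * y = b%:R - a%:R by rewrite /y mulrC divfK// pnatr_eq0 -lt0n.
have := expiD (b%:R - a%:R) (a%:R : R); rewrite subrK !expi_nat mulr1 => <-.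
by rewrite subrr.
Qed.

Lemma sum_progression {V : nmodType} (F : nat -> V) (q K : nat) :
  \sum_(0 <= n < q * K) F n = \sum_(0 <= m < K) \sum_(0 <= b < q) F (q * m + b)%N.
Proof.
elim: K => [|K IH]; first by rewrite muln0 !big_geq.
rewrite big_nat_recr//= -IH mulnS addnC (@big_cat_nat _ _ _ (q * K))//= ?leq_addr//.
by rewrite -{2}[(q * K)%N]add0n big_addn addKn; congr (_ + _); apply: eq_bigr => i _; rewrite addnC.
Qed.

Lemma progression_sum_detect {R : realType} (F : nat -> R[i]) (beta : R) (a q K : nat) :
  (a < q)%N ->
  q%:R * \sum_(0 <= m < K) F (q * m + a)%N * expi (m%:R * beta) =
  \sum_(0 <= h < q) expi (- (a%:R * ((beta + h%:R) / q%:R))) *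
     \sum_(0 <= n < q * K) F n * expi (n%:R * ((beta + h%:R) / q%:R)).
Proof.
move=> aq; have q0 : (0 < q)%N by exact: leq_trans aq.
have qR : q%:R != 0 :> R by rewrite pnatr_eq0 -lt0n.
under [RHS]eq_bigr do rewrite mulr_sumr.
rewrite exchange_big_nat/= sum_progression mulr_sumr; apply: eq_bigr => m _.
(* For n = q m + b the h-dependent part of the phase is h(b - a)/q + m h. The integer m h
   disappears, and summation over h singles out b = a. *)
rewrite (eq_big_nat _ _ (F2 := fun b => F (q * m + b)%N *
   expi ((q%:R * m%:R + b%:R - a%:R) * (beta / q%:R)) * (if b == a then q%:R else 0))); last first.
  move=> b /andP[_ bq]; rewrite -sum_expi_frac// mulr_sumr; apply: eq_bigr => h _.
  rewrite mulrCA -[RHS]mulrA -!expiD; congr (_ * _).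
  have -> : - (a%:R * ((beta + h%:R) / q%:R)) + (q * m + b)%:R * ((beta + h%:R) / q%:R) =
     (q%:R * m%:R + b%:R - a%:R) * (beta / q%:R) + h%:R * ((b%:R - a%:R) / q%:R) + (m * h)%:R.
    by rewrite natrD !natrM; field.
  by rewrite [LHS]expiD expi_nat mulr1.
rewrite (bigD1_seq a) ?iota_uniq ?mem_index_iota//= eqxx big1 ?addr0; last first.
  by move=> b /negPf ->; rewrite mulr0.
have -> : (q%:R * m%:R + a%:R - a%:R) * (beta / q%:R) = m%:R * beta by field.
by rewrite mulrC.
Qed.

Lemma mangoldt_progression_sum_le {R : realType} (beta C : R) (a q K : nat) :
  (a < q)%N ->
  (forall h : nat,
    normc (\sum_(1 <= n < q * K)
      (von_mangoldt n)%:C%C * expi (n%:R * ((beta + h%:R) / q%:R))) <= C) ->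
  normc (\sum_(0 <= m < K) (von_mangoldt (q * m + a))%:C%C * expi (m%:R * beta)) <= C.
Proof.
move=> aq hC; have q0 : (0 < q)%N by exact: leq_trans aq.
have qR : 0 < q%:R :> R by rewrite ltr0n.
rewrite -(ler_pM2l qR) -{1}(ger0_norm (ltW qR)) -normc_real -Normc.normcM.
have -> : (q%:R)%:C%C = q%:R :> R[i] by exact: rmorph_nat.
rewrite (@progression_sum_detect R (fun n => (von_mangoldt n)%:C%C) beta)//.
apply: le_trans (normc_sum _ _ _ _) _.
apply: (@le_trans _ _ (\sum_(0 <= h < q) C)); last by rewrite sumr_const_nat subn0 mulr_natl.
apply: ler_sum => h _; rewrite Normc.normcM normc_expi mul1r.
apply: le_trans (hC h).
(* The term n = 0 drops out because [von_mangoldt] vanishes at 0. *)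
have [K0|K0] := posnP (q * K)%N; first by rewrite K0 !big_geq.
by rewrite big_ltn// /von_mangoldt/= mul0r add0r.
Qed.

(** * Diophantine approximation and choice of parameters *)

(** The limit inferior is the supremum of the nonnegative tail infima; if it is not 0, some tail
    infimum is positive, and it is finite because it lies below a value of u. An infinite limit is
    covered as well. *)
Lemma limn_einf_neq0 {R : realType} (u : nat -> R) :
  (forall n, 0 <= u n) -> limn_einf (fun n => (u n)%:E) <> 0%E ->
  exists2 c : R, 0 < c & exists n0, forall n, (n0 <= n)%N -> c <= u n.
Proof.
move=> u0 lu; pose v := fun n => (u n)%:E.
have lE : limn_einf v = ereal_sup (range (einfs v)).
  by rewrite limn_einf_lim; apply/cvg_lim => //; exact: cvg_einfs_sup.
have inf0 n : (0 <= einfs v n)%E.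
  by apply: le_ereal_inf_tmp => _ [k _ <-]; rewrite lee_fin.
have infle n k : (n <= k)%N -> (einfs v n <= (u k)%:E)%E.
  by move=> nk; apply: ereal_inf_lbound; exists k.
have [[n n0]|h] := pselect (exists n, (0 < einfs v n)%E); last first.
  exfalso; apply: lu; rewrite -/v lE; apply/eqP; rewrite eq_le; apply/andP; split.
    apply: ge_ereal_sup => _ [n _ <-]; rewrite leNgt; apply/negP => n0.
    by apply: h; exists n.
  by apply: le_trans (inf0 0%N) _; apply: ereal_sup_ubound; exists 0%N.
have fin : einfs v n \is a fin_num.
  by rewrite ge0_fin_numE// (le_lt_trans (infle n n (leqnn n)))// ltry.
exists (fine (einfs v n)); first by rewrite fine_gt0// n0 ltey_eq fin.
by exists n => k nk; rewrite -lee_fin fineK// infle.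
Qed.

(** As rho exceeds the supremum, the limit inferior is nonzero, which gives a bound for n >= n0. For
    smaller n it is applied to n t with t = n0 + 1, and ||gamma n t|| <= t ||gamma n||; hence the
    constant c/(t^rho t). *)
Lemma irr_type_lower_bound {R : realType} (gamma tau rho : R) :
  irr_type gamma = tau%:E -> tau < rho ->
  exists2 c : R, 0 < c & forall n, (0 < n)%N -> c <= n%:R `^ rho * dist_int (gamma * n%:R).
Proof.
move=> tauE tr.
have [||c c0 [n0 hc]] := @limn_einf_neq0 R (fun n => n%:R `^ rho * dist_int (gamma * n%:R)).
- by move=> n; rewrite mulr_ge0 ?powR_ge0 ?dist_int_ge0.
- move=> h; move: tr; rewrite ltNge => /negP; apply.
  by rewrite -lee_fin -tauE; apply: ereal_sup_ubound; exists rho.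
pose t := n0.+1; have tR : 0 < t%:R :> R by rewrite ltr0n.
exists (c / (t%:R `^ rho * t%:R)); first by rewrite divr_gt0// mulr_gt0// powR_gt0.
move=> n n1; rewrite ler_pdivrMr ?mulr_gt0 ?powR_gt0//.
apply: le_trans (hc (n * t)%N _) _; first by rewrite /t; nia.
have := dist_intMn (gamma * n%:R) t; rewrite natrM powRM//.
have -> : t%:R * (gamma * n%:R) = gamma * (n%:R * t%:R) by ring.
move=> h.
have -> : n%:R `^ rho * dist_int (gamma * n%:R) * (t%:R `^ rho * t%:R) =
  n%:R `^ rho * t%:R `^ rho * (t%:R * dist_int (gamma * n%:R)) by ring.
by rewrite ler_wpM2l// mulr_ge0// powR_ge0.
Qed.

(** Pigeonhole: two of the Q + 1 fractional parts of x i, 0 <= i <= Q, fall into the same interval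
    of length 1/Q. *)
Lemma dirichlet_approx {R : realType} (x : R) (Q : nat) : (0 < Q)%N ->
  exists2 j : nat, (0 < j <= Q)%N & dist_int (x * j%:R) <= Q%:R^-1.
Proof.
move=> Q0; have QR : 0 < Q%:R :> R by rewrite ltr0n.
pose fr (i : nat) := x * i%:R - (Num.floor (x * i%:R))%:~R.
have fr01 i : 0 <= fr i < 1.
  have /andP[h1 h2] := floor_itv (x * i%:R).
  by rewrite intrD in h2; rewrite /fr; apply/andP; split; lra.
have bin i : (Num.truncn (Q%:R * fr i) < Q)%N.
  have /andP[f0 f1] := fr01 i.
  rewrite -(ltr_nat R); have /andP[+ _] := truncn_itv (mulr_ge0 (ltW QR) f0).
  by move/le_lt_trans; apply; rewrite -[ltRHS]mulr1 ltr_pM2l.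
pose f (i : 'I_Q.+1) : 'I_Q := Ordinal (bin i).
have /injectivePn[i [j ij fij]] : ~~ injectiveb f.
  by apply/negP => /injectiveP/leq_card; rewrite !card_ord ltnn.
wlog ltij : i j ij fij / (i < j)%N.
  move=> hw; case: (ltngtP i j) => h; first exact: hw fij h.
    by apply: hw (esym fij) h; rewrite eq_sym.
  by move: ij; rewrite (val_inj h) eqxx.
exists (j - i)%N; first by have := ltn_ord j; lia.
have /(congr1 val)/= tij := fij.
have /andP[i0 i1] := fr01 i; have /andP[j0 j1] := fr01 j.
have /andP[a1 a2] := truncn_itv (mulr_ge0 (ltW QR) i0).
have /andP[b1 b2] := truncn_itv (mulr_ge0 (ltW QR) j0).
rewrite -tij in b1 b2.
apply: le_trans (dist_int_le _ (Num.floor (x * j%:R) - Num.floor (x * i%:R))) _.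
rewrite natrB ?(ltnW ltij)// intrB.
have -> : x * (j%:R - i%:R) -
    ((Num.floor (x * j%:R))%:~R - (Num.floor (x * i%:R))%:~R) = fr j - fr i.
  by rewrite /fr; ring.
rewrite -[leRHS]mul1r ler_pdivlMr// -[X in _ * X](ger0_norm (ltW QR)) -normrM ler_norml.
by rewrite -natr1 in a2 b2; apply/andP; split; lra.
Qed.

Lemma powR_eventually_ge {R : realType} (C e : R) : 0 < e ->
  exists M0 : R, forall M, M0 <= M -> C <= M `^ e.
Proof.
move=> e0; exists (Num.max 1 (Num.max C 1 `^ e^-1)) => M.
rewrite ge_max => /andP[M1 MC]; apply: (@le_trans _ _ (Num.max C 1)); first by rewrite le_max lexx.
have C1 : 0 <= Num.max C 1 by rewrite le_max ler01 orbT.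
have -> : Num.max C 1 = (Num.max C 1 `^ e^-1) `^ e.
  by rewrite -powRrM mulVf ?lt0r_neq0// powRr1.
by apply: ge0_ler_powR => //; rewrite ?nnegrE ?powR_ge0 ?(ltW e0) ?(le_trans ler01 M1)//.
Qed.

(** Dirichlet's theorem gives c <= Q^(rho - 1) for every Q >= 1, which fails for large Q if rho <
    1. *)
Lemma irrationality_exponent_ge1 {R : realType} (gamma rho c : R) : 0 < c -> 0 <= rho ->
  (forall n, (0 < n)%N -> c <= n%:R `^ rho * dist_int (gamma * n%:R)) -> 1 <= rho.
Proof.
move=> c0 rho0 hc; rewrite leNgt; apply/negP => rho1.
have [M0 hM] := @powR_eventually_ge R (2 / c) (1 - rho) ltac:(by rewrite subr_gt0).
pose Q := (Num.truncn `|M0|).+1; have QR : 0 < Q%:R :> R by rewrite ltr0n.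
have MQ : M0 <= Q%:R.
  by apply: le_trans (ler_norm _) _; have /andP[_ /ltW] := truncn_itv (normr_ge0 M0).
have [j /andP[j0 jQ] dj] := @dirichlet_approx R gamma Q (ltn0Sn _).
have h1 : c <= Q%:R `^ rho / Q%:R.
  apply: le_trans (hc j j0) _; rewrite ler_pM ?powR_ge0 ?dist_int_ge0//.
  by apply: ge0_ler_powR; rewrite ?nnegrE// ler_nat.
have := hM _ MQ; rewrite powRB ?powRr1 ?(gt_eqF QR) ?implybT// ?(ltW QR)// => h2.
have p0 : 0 < Q%:R `^ rho by rewrite powR_gt0.
have : 2 / c * c <= Q%:R / Q%:R `^ rho * (Q%:R `^ rho / Q%:R).
  by rewrite ler_pM// ?divr_ge0// ltW.
rewrite divfK ?gt_eqF// mulrA divfK ?gt_eqF// divff ?gt_eqF//; lra.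
Qed.

(** * Choice of parameters and conclusion *)

Lemma truncn_ge_half {R : realType} (x : R) : 1 <= x -> x / 2 <= (Num.truncn x)%:R <= x.
Proof.
move=> x1; have /andP[h1 h2] := truncn_itv (le_trans ler01 x1).
rewrite h1 andbT; rewrite -natr1 in h2.
have : 1 <= (Num.truncn x)%:R :> R by rewrite ler1n truncn_gt0.
lra.
Qed.

(** Multiplying by q turns the frequency into gamma k j plus the integer j h, so the bound is
    uniform in h. *)
Lemma dist_int_progression_freq {R : realType} (gamma rho c : R) (k q h j : nat) :
  (0 < q)%N -> (0 < k)%N -> (0 < j)%N ->
  (forall n, (0 < n)%N -> c <= n%:R `^ rho * dist_int (gamma * n%:R)) ->
  c <= q%:R * (k%:R * j%:R) `^ rho * dist_int (j%:R * ((gamma * k%:R + h%:R) / q%:R)).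
Proof.
move=> q0 k0 j0 hc; have qR : q%:R != 0 :> R by rewrite pnatr_eq0 -lt0n.
have := hc (k * j)%N; rewrite muln_gt0 k0 j0 => /(_ isT); rewrite natrM => /le_trans; apply.
rewrite [q%:R * _]mulrC -mulrA ler_wpM2l ?powR_ge0//.
apply: le_trans (dist_intMn _ _).
have -> : q%:R * (j%:R * ((gamma * k%:R + h%:R) / q%:R)) = gamma * (k%:R * j%:R) + (j * h)%:Z%:~R.
  by rewrite -pmulrn natrM; field.
by rewrite dist_intDz.
Qed.

Lemma mangoldt_twist_le {R : realType} (gamma rho c e M : R) (k a q : nat) :
  0 < c -> (forall n, (0 < n)%N -> c <= n%:R `^ rho * dist_int (gamma * n%:R)) ->
  1 <= rho -> 0 < e -> e * rho < 1 / 8 -> 2 <= M -> 2 / c <= M `^ (1 / 64) ->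
  1 <= (k%:R : R) <= M `^ e -> (a < q)%N -> q%:R <= M `^ (e / 4) ->
  normc (\sum_(0 <= m < (Num.truncn M).+1)
    (von_mangoldt (q * m + a))%:C%C * expi (m%:R * (gamma * k%:R))) <=
  48 * (1 + 3 * ln M) ^+ 4 * M `^ (1 - e / 16).
Proof.
move=> c0 hc rho1 e0 erho M2 Mc /andP[k1 kM] aq qM.
have q0 : (0 < q)%N by exact: leq_trans aq.
have k0 : (0 < k)%N by rewrite -(ler1n R).
have M0 : 0 < M by lra.
have M1 : 1 <= M by lra.
have e8 : e < 1 / 8 by nra.
have Mp1 t : 0 <= t -> 1 <= M `^ t by move=> t0; rewrite -[leLHS](powRr0 M) ler_powR.
have MD u v : M `^ u * M `^ v = M `^ (u + v).
  by rewrite powRD// (gt_eqF M0) implybT.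
pose s := Num.truncn (M `^ (5 * e / 16)).
have /andP[s1 s2] : M `^ (5 * e / 16) / 2 <= s%:R <= M `^ (5 * e / 16).
  by apply/truncn_ge_half/Mp1; lra.
pose U := Num.truncn (M `^ (21 / 64)).
have /andP[U1 U2] : M `^ (21 / 64) / 2 <= U%:R <= M `^ (21 / 64).
  by apply/truncn_ge_half/Mp1; lra.
have s0 : (0 < s)%N by rewrite truncn_gt0 Mp1//; lra.
have U0 : (0 < U)%N by rewrite truncn_gt0 Mp1//; lra.
(* The term e/4 comes from q, and 13/8 from k j <= k s^2 <= M^(e + 5e/8). *)
pose delta := c * M `^ (- (e / 4 + 13 / 8 * (e * rho))).
have d0 : 0 < delta by rewrite mulr_gt0// powR_gt0.
pose N := (q * (Num.truncn M).+1).-1.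
have NE : N.+1 = (q * (Num.truncn M).+1)%N by rewrite prednK// muln_gt0 q0.
have /andP[tM1 tM2] := truncn_itv (ltW M0).
have qR : 1 <= q%:R :> R by rewrite ler1n.
have NM : M < N.+1%:R by rewrite NE natrM; nra.
have NR : N.+1%:R <= 2 * M `^ (1 + e / 4).
  rewrite NE natrM -natr1 -MD powRr1 ?(ltW M0)// mulrCA mulrA [leRHS]mulrC.
  by rewrite ler_pM//; lra.
have sep h j : (0 < j <= s ^ 2)%N ->
    delta <= dist_int (j%:R * ((gamma * k%:R + h%:R) / q%:R)).
  move=> /andP[j0 js].
  have := @dist_int_progression_freq R gamma rho c k q h j q0 k0 j0 hc.
  set D := dist_int _ => hD; have D0 : 0 <= D by exact: dist_int_ge0.
  have kj : (k%:R * j%:R) `^ rho <= M `^ (13 / 8 * (e * rho)).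
    rewrite (_ : 13 / 8 * (e * rho) = (e + 5 * e / 16 + 5 * e / 16) * rho); last by field.
    rewrite powRrM; apply: ge0_ler_powR; rewrite ?nnegrE ?powR_ge0 ?mulr_ge0//; first by lra.
    rewrite -!MD -mulrA ler_pM//.
    apply: (@le_trans _ _ (s%:R * s%:R)); first by rewrite -natrM mulnn ler_nat.
    by rewrite ler_pM.
  rewrite /delta powRN ler_pdivrMr ?powR_gt0//; apply: le_trans hD _.
  rewrite mulrC -MD ler_wpM2l// ler_pM// powR_ge0.
have rU : (s ^ 2)%:R <= delta * U%:R.
  rewrite natrX expr2.
  apply: (@le_trans _ _ (M `^ (5 * e / 16) * M `^ (5 * e / 16))); first by rewrite ler_pM.
  apply: (@le_trans _ _ (delta * (M `^ (21 / 64) / 2))); last by rewrite ler_wpM2l// ltW.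
  have -> : delta * (M `^ (21 / 64) / 2) =
      c / 2 * (M `^ (- (e / 4 + 13 / 8 * (e * rho))) * M `^ (21 / 64)).
    by rewrite /delta; field.
  rewrite !MD.
  (* Since e <= e rho < 1/8, the second bracket exceeds 21/64 - 20/64 = 1/64, and M^(1/64) absorbs
     2/c. *)
  have -> : - (e / 4 + 13 / 8 * (e * rho)) + 21 / 64 =
    (5 * e / 16 + 5 * e / 16) + (21 / 64 - 7 / 8 * e - 13 / 8 * (e * rho)) by field.
  rewrite -[in leRHS]MD mulrCA ler_peMr ?powR_ge0//.
  apply: (@le_trans _ _ (c / 2 * M `^ (1 / 64))).
    by rewrite -ler_pdivrMl ?divr_gt0// mulr1 invf_div.
  by rewrite ler_wpM2l ?divr_ge0 ?(ltW c0)// ler_powR//; nra.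
have U3 : (U ^ 3 <= N)%N.
  rewrite -ltnS -(ltr_nat R); apply: le_lt_trans NM; rewrite natrX.
  apply: (@le_trans _ _ ((M `^ (21 / 64)) ^+ 3)).
    by rewrite lerXn2r ?nnegrE ?powR_ge0.
  rewrite -powR_mulrn ?powR_ge0// -powRrM -[leRHS]powRr1 ?(ltW M0)//.
  by rewrite ler_powR//; lra.
have N0 : (0 < N)%N by apply: leq_trans U3; rewrite expn_gt0 U0.
have NR0 : 0 < N%:R :> R by rewrite ltr0n.
have NN : N%:R <= N.+1%:R :> R by rewrite ler_nat.
have LN : ln (N%:R : R) <= 3 * ln M.
  rewrite mulr_natl -lnXn// ler_ln ?posrE ?exprn_gt0//.
  apply: le_trans NN _; apply: le_trans NR _.
  rewrite exprS; apply: ler_pM => //; first exact: powR_ge0.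
  by rewrite -powR_mulrn ?(ltW M0)// ler_powR//; lra.
have main : forall h : nat, normc (\sum_(1 <= n < q * (Num.truncn M).+1)
    (von_mangoldt n)%:C%C * expi (n%:R * ((gamma * k%:R + h%:R) / q%:R))) <=
    48 * (1 + 3 * ln M) ^+ 4 * M `^ (1 - e / 16).
  move=> h; rewrite -NE.
  apply: le_trans (@mangoldt_expi_sum_le R _ delta s U N s0 d0 (sep h) U0 U3 rU) _.
  have lnN0 : 0 <= ln (N%:R : R) by rewrite ln_ge0// ler1n.
  apply: (@le_trans _ _ (12 * (1 + 3 * ln M) ^+ 4 * (4 * M `^ (1 - e / 16)))); last first.
    by rewrite le_eqVlt; apply/orP; left; apply/eqP; ring.
  apply: ler_pM.
  - by rewrite mulr_ge0// exprn_ge0// addr_ge0.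
  - by rewrite divr_ge0.
  - by rewrite ler_wpM2l// lerXn2r ?nnegrE//; clear -lnN0 LN; lra.
  rewrite ler_pdivrMr ?ltr0n//.
  apply: le_trans NN _; apply: le_trans NR _.
  (* The gain 5e/16 from s beats the loss e/4 from q by e/16. The factor 4 collects the 2 in the
     bound for N and the 2 lost in truncating s. *)
  rewrite (_ : 1 + e / 4 = (1 - e / 16) + 5 * e / 16); last by field.
  rewrite -MD; have := ler_wpM2l (powR_ge0 M (1 - e / 16)) s1.
  by clear; lra.
exact: (@mangoldt_progression_sum_le R (gamma * k%:R) _ a q _ aq main).
Qed.

Theorem theorem4p1 (R : realType) (gamma tau : R) (eps : R) :
  irrational gamma ->
  irr_type gamma = tau%:E ->
  0 < eps < 1 / (8 * tau) ->
  exists2 eta : R, 0 < eta &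
  exists M0 : R, forall M : R, M0 <= M ->
  forall k a q : nat,
    1 <= (k%:R : R) <= M `^ eps ->
    (a < q)%N ->
    q%:R <= M `^ (eps / 4) ->
    coprime a q ->
    `| \sum_(1 <= m < (Num.truncn M).+1)
         (von_mangoldt (q * m + a))%:C%C * expi (gamma * k%:R * m%:R) |
    <= (M `^ (1 - eta))%:C%C.
Proof.
move=> _ tauE /andP[e0 etau].
have tau0 : 0 < tau.
  have := lt_trans e0 etau; rewrite div1r invr_gt0; lra.
have etau8 : eps * tau < 1 / 8.
  by move: etau; rewrite ltr_pdivlMr; [lra|rewrite mulr_gt0].
(* The midpoint of tau and 1/(8 eps) gives both tau < rho and eps rho < 1/8. *)
pose rho := (tau + 1 / (8 * eps)) / 2.
have erho : eps * rho = (eps * tau + 1 / 8) / 2.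
  by rewrite /rho; field; rewrite gt_eqF.
have taurho : tau < rho by rewrite -(ltr_pM2l e0); lra.
have [c c0 hc] := @irr_type_lower_bound R gamma tau rho tauE taurho.
have rho1 : 1 <= rho.
  by apply: (@irrationality_exponent_ge1 R gamma rho c) => //; lra.
have e8 : eps < 1 / 8 by nra.
(* The fourth power of the logarithm will then cost M^(eps/64). *)
pose kap := eps / 256.
have kap0 : 0 < kap by rewrite /kap; lra.
pose A := 1 + 3 / kap.
have A1 : 1 <= A by rewrite lerDl divr_ge0// ltW.
have [M1 hM1] := @powR_eventually_ge R (2 / c) (1 / 64) ltac:(lra).
have [M2 hM2] := @powR_eventually_ge R (49 * A ^+ 4) (eps / 32) ltac:(lra).
(* The budget is eps/16 saved, less eps/64 for the logarithms and eps/32 for the constant 49 A^4. *)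
exists (eps / 64); first by rewrite divr_gt0.
exists (Num.max 2 (Num.max M1 M2)) => M; rewrite !ge_max => /and3P[M2le /hM1 Mc /hM2 MA].
move=> k a q kM aq qM _.
have M0 : 0 < M by lra.
have LA : 1 + 3 * ln M <= A * M `^ kap.
  have h : kap * ln M <= M `^ kap by rewrite -ln_powR ltW// ln_sublinear// powR_gt0.
  have h1 : 1 <= M `^ kap by rewrite -[leLHS](powRr0 M) ler_powR//; lra.
  have h2 : ln M <= M `^ kap / kap by rewrite ler_pdivlMr// mulrC.
  have -> : A * M `^ kap = M `^ kap + 3 * (M `^ kap / kap) by rewrite /A; ring.
  lra.
have lnM0 : 0 <= ln M by rewrite ln_ge0//; lra.
have L1 : 1 <= 1 + 3 * ln M by lra.
have L4 : (1 + 3 * ln M) ^+ 4 <= A ^+ 4 * M `^ (eps / 64).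
  apply: (@le_trans _ _ ((A * M `^ kap) ^+ 4)).
    by rewrite lerXn2r ?nnegrE ?mulr_ge0 ?powR_ge0//; lra.
  rewrite exprMn -[(M `^ _) ^+ 4]powR_mulrn ?powR_ge0// -powRrM.
  by rewrite (_ : kap * 4%:R = eps / 64)// /kap; field.
have q0 : (0 < q)%N by exact: leq_trans aq.
have La : von_mangoldt a <= (1 + 3 * ln M) ^+ 4.
  apply: le_trans (von_mangoldt_le a q (ltnW aq)) _.
  apply: (@le_trans _ _ (1 + 3 * ln M)); last by rewrite -{1}[1 + _]expr1 ler_weXn2l.
  rewrite lerD2l; apply: (@le_trans _ _ (ln M)); last by lra.
  rewrite ler_ln ?posrE ?ltr0n//; apply: le_trans qM _.
  by rewrite -[leRHS]powRr1 ?(ltW M0)// ler_powR//; clear -e8 M2le; lra.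
have B := @mangoldt_twist_le R gamma rho c eps M k a q c0 hc rho1 e0 ltac:(lra) M2le Mc kM aq qM.
set S := \sum_(_ <= _ < _) _.
have -> : `|S| = (normc S)%:C%C by rewrite normc_def; case: S.
rewrite lecR.
(* The progression bound includes m = 0, so Lambda(a) is subtracted; by [La] this raises the
   constant from 48 to 49. *)
have -> : S = \sum_(0 <= m < (Num.truncn M).+1)
    (von_mangoldt (q * m + a))%:C%C * expi (m%:R * (gamma * k%:R)) - (von_mangoldt a)%:C%C.
  rewrite big_ltn// muln0 add0n mul0r expi0 mulr1 [X in X - _]addrC addrK.
  by apply: eq_bigr => m _; rewrite [m%:R * _]mulrC.
apply: le_trans (le_normcD _ _) _; rewrite normcN normc_real ger0_norm ?von_mangoldt_ge0//.
have P1 : 1 <= M `^ (1 - eps / 16).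
  by rewrite -[leLHS](powRr0 M) ler_powR//; clear -e8 M2le; lra.
have L40 : 0 <= (1 + 3 * ln M) ^+ 4 by rewrite exprn_ge0//; clear -L1; lra.
apply: (@le_trans _ _ (49 * (1 + 3 * ln M) ^+ 4 * M `^ (1 - eps / 16))).
  by clear -La B P1 L40; nra.
apply: (@le_trans _ _ (49 * (A ^+ 4 * M `^ (eps / 64)) * M `^ (1 - eps / 16))).
  by rewrite ler_wpM2r ?powR_ge0// ler_wpM2l.
have MD u v : M `^ u * M `^ v = M `^ (u + v).
  by rewrite powRD// (gt_eqF M0) implybT.
rewrite mulrA -mulrA MD.
apply: (@le_trans _ _ (M `^ (eps / 32) * M `^ (eps / 64 + (1 - eps / 16)))).
  by rewrite ler_wpM2r ?powR_ge0.
by rewrite MD ler_powR//; clear -e0 M2le; lra.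
Qed.
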